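(* Let $k \ge 1$ and let $P \subset \mathbb{R}_{>0}^k$ be a fixed convex polytope defined by finitely many linear inequalities with rational coefficients. Then the integral $$ I(P) = \int_P \frac{\mathrm{d}t}{t_1 t_2 \cdots t_k} $$ can be approximated with precision $2^{-n}$ in time $O(n^{O(1)})$. That is, there are an algorithm (depending on $P$) and a constant $C>0$ such that, given an integer $n \ge 1$, the algorithm outputs a rational number $q_n$ with $|q_n - I(P)| \le 2^{-n}$ in time $O(n^{C})$, where $C$ and the implied constant may depend on $k$ and $P$ but not on $n$.
   Context: Here $t = (t_1,\dots,t_k)$, $\mathrm{d}t$ is the Lebesgue measure on $\mathbb{R}^k$, and $\mathbb{R}_{>0}^k$ is the set of vectors with all coordinates positive. A convex polytope is a bounded (compact) intersection of finitely many closed half-spaces. Time is measured in bit operations. *)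

(* Defs.v *)
From HB Require Import structures.
From mathcomp Require Import all_boot all_order all_algebra.
From mathcomp Require Import all_classical all_reals all_analysis.

Set Implicit Arguments.
Unset Strict Implicit.
Unset Printing Implicit Defensive.

Import Order.TTheory GRing.Theory Num.Theory.

Local Open Scope classical_set_scope.
Local Open Scope ring_scope.

(* Lebesgue measure on [R^k] is built by induction on [k], on [k.-tuple R] with
   the library's product sigma-algebra: [cons_measure mu] is the image of the
   product of Lebesgue measure on [R] with [mu] under [(x, t) |-> x :: t].  The
   type [measurableTypeR R] is [R] as the measurable space on which the library
   defines [lebesgue_measure]. *)
Section cons_measure.
Local Open Scope ereal_scope.
Context (R : realType) (k : nat).
Variable mu : {sigma_finite_measure set (k.-tuple R) -> \bar R}.

Definition cons_pair (xt : measurableTypeR R * k.-tuple R) : k.+1.-tuple R :=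
  [tuple of (xt.1 : R) :: xt.2].

Lemma measurable_cons_pair : measurable_fun setT cons_pair.
Proof.
apply: (@measurable_cons _ _ _ R) => //; exact: measurable_fst.
Qed.

Definition cons_measure : set (k.+1.-tuple R) -> \bar R :=
  pushforward (@lebesgue_measure R \x mu) cons_pair.

Let cons_measure0 : cons_measure set0 = 0.
Proof. by rewrite /cons_measure /pushforward preimage_set0 measure0. Qed.

Let cons_measure_ge0 A : 0 <= cons_measure A.
Proof. exact: (measure_ge0 (@lebesgue_measure R \x mu)). Qed.

Let cons_measure_sigma_additive : semi_sigma_additive cons_measure.
Proof.
have H := @measure_semi_sigma_additive _ _ _
  (@measure_function_pushforward__canonical__measure_function_Measure
     _ _ _ _ _ (@lebesgue_measure R \x mu) _ measurable_cons_pair).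
exact: H.
Qed.

HB.instance Definition _ := isMeasure.Build _ _ _ cons_measure
  cons_measure0 cons_measure_ge0 cons_measure_sigma_additive.

Definition uncons (t : k.+1.-tuple R) : measurableTypeR R * k.-tuple R :=
  (thead t, [tuple of behead t]).

Lemma cons_pairK : cancel cons_pair uncons.
Proof.
by move=> [x t]; rewrite /uncons theadE; congr (_, _); exact: val_inj.
Qed.

Lemma measurable_uncons : measurable_fun setT uncons.
Proof.
apply/measurable_fun_pairP; split; first exact: (@measurable_tnth _ R).
exact: measurable_behead.
Qed.

Lemma cons_measureX (A : set R) (B : set (k.-tuple R)) :
  measurable A -> measurable B ->
  cons_measure (uncons @^-1` (A `*` B)) = lebesgue_measure A * mu B.
Proof.
move=> mA mB; rewrite /cons_measure /pushforward -comp_preimage.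
rewrite (_ : uncons \o cons_pair = id); last exact/funext/cons_pairK.
exact: product_measure1E.
Qed.

Let cons_measure_sigma_finite : sigma_finite setT cons_measure.
Proof.
have /sigma_finiteP[F [FT ndF Foo]] := sigma_finiteT (@lebesgue_measure R).
have /sigma_finiteP[G [GT ndG Goo]] := sigma_finiteT mu.
exists (fun n => uncons @^-1` (F n `*` G n)).
  apply/esym/seteqP; split=> // t _.
  have : [set: R] (uncons t).1 by []; rewrite FT => -[i _ Fi].
  have : [set: k.-tuple R] (uncons t).2 by []; rewrite GT => -[j _ Gj].
  exists (maxn i j) => //; split.
    by move: (_.1) Fi; exact/subsetPset/ndF/leq_maxl.
  by move: (_.2) Gj; exact/subsetPset/ndG/leq_maxr.
move=> n; have [mF Fn] := Foo n; have [mG Gn] := Goo n; split.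
  rewrite -[X in measurable X]setTI; apply: measurable_uncons => //.
  exact: measurableX.
by rewrite cons_measureX// lte_mul_pinfty// ge0_fin_numE.
Qed.

HB.instance Definition _ := Measure_isSigmaFinite.Build _ _ _ cons_measure
  cons_measure_sigma_finite.

End cons_measure.

Fixpoint lebesgue_tuple (R : realType) (k : nat) :
    {sigma_finite_measure set (k.-tuple R) -> \bar R} :=
  match k with
  | 0%N => \d_([tuple] : 0.-tuple R)
  | k'.+1 => cons_measure (lebesgue_tuple R k')
  end.

Lemma lebesgue_tuple_box (R : realType) (k : nat) (A : 'I_k -> set R) :
  (forall i, measurable (A i)) ->
  lebesgue_tuple R k [set t | forall i, A i (tnth t i)] =
  (\prod_(i < k) lebesgue_measure (A i))%E.
Proof.
elim: k A => [|k IHk] A mA.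
  by rewrite big_ord0 /= diracE mem_set// => -[].
rewrite big_ord_recl -IHk// /= -cons_measureX//; last first.
  rewrite (_ : mkset _ =
      \bigcap_(i in [set: 'I_k]) ((@tnth k R)^~ i @^-1` A (lift ord0 i))).
    apply: fin_bigcap_measurable => // i _.
    rewrite -[X in measurable X]setTI; exact: measurable_tnth.
  by apply/seteqP; split=> t /= At i; [move=> _|]; exact: At.
congr (cons_measure _ _); apply/seteqP; split=> t /=.
  move=> At; split; first exact: At.
  by move=> i; have := At (lift ord0 i); rewrite [t in tnth t _]tuple_eta tnthS.
move=> [A0 At] i; case: (unliftP ord0 i) => [j|] -> //.
by rewrite [t in tnth t _]tuple_eta tnthS; exact: At.
Qed.

Definition polyhedron (R : realType) (m k : nat) (A : 'M[rat]_(m, k))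
    (b : 'cV[rat]_m) : set (k.-tuple R) :=
  [set t | forall i, \sum_(j < k) ratr (A i j) * tnth t j <= ratr (b i ord0)].

Definition bounded_tuples (R : realType) (k : nat) (P : set (k.-tuple R)) :=
  exists M : R, forall t, P t -> forall i, `|tnth t i| <= M.

Definition rational_polytope (R : realType) (k : nat) (P : set (k.-tuple R)) :=
  bounded_tuples P /\
  exists (m : nat) (A : 'M[rat]_(m, k)) (b : 'cV[rat]_m), P = polyhedron A b.

Definition positive_orthant (R : realType) (k : nat) : set (k.-tuple R) :=
  [set t | forall i, 0 < tnth t i].

Definition inv_prod_integral (R : realType) (k : nat) (P : set (k.-tuple R)) :
    \bar R :=
  (\int[lebesgue_tuple R k]_(t in P) ((\prod_(i < k) tnth t i)^-1)%:E)%E.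

(* Model of computation: structured programs over finitely many stacks of bits
   (those that occur in the program), all initially empty except the input.
   Every executed instruction and every evaluation of a test inspects or changes
   one bit at the top of one stack and costs one bit operation.  Since two stacks
   make a Turing tape, running times agree with those of multitape Turing machines
   up to a constant factor that depends on the program. *)
Inductive test := Nonempty (x : nat) | Top (x : nat).

Inductive prog :=
  | Push (b : bool) (x : nat)
  | Pop (x : nat)
  | Seq (p q : prog)
  | If (c : test) (p q : prog)
  | While (c : test) (p : prog).

Definition store := nat -> seq bool.

Definition update (s : store) (x : nat) (v : seq bool) : store :=
  fun y => if y == x then v else s y.

Definition holds (c : test) (s : store) : bool :=
  match c with
  | Nonempty x => s x != [::]
  | Top x => head false (s x)
  end.

(* [exec p s t s']: started in [s], the program [p] halts in [s'] after exactly
   [t] bit operations. *)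
Inductive exec : prog -> store -> nat -> store -> Prop :=
  | exec_push b x s : exec (Push b x) s 1 (update s x (b :: s x))
  | exec_pop x s : exec (Pop x) s 1 (update s x (behead (s x)))
  | exec_seq p q s1 s2 s3 t1 t2 :
      exec p s1 t1 s2 -> exec q s2 t2 s3 -> exec (Seq p q) s1 (t1 + t2)%N s3
  | exec_if_true c p q s s' t :
      holds c s -> exec p s t s' -> exec (If c p q) s t.+1 s'
  | exec_if_false c p q s s' t :
      ~~ holds c s -> exec q s t s' -> exec (If c p q) s t.+1 s'
  | exec_while_true c p s1 s2 s3 t1 t2 :
      holds c s1 -> exec p s1 t1 s2 -> exec (While c p) s2 t2 s3 ->
      exec (While c p) s1 (t1 + t2).+1 s3
  | exec_while_false c p s : ~~ holds c s -> exec (While c p) s 1 s.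

(* Binary expansions have the least significant bit first, on top of the stack;
   [bits_of_nat n] has no leading zeros. *)
Definition bits_of_nat (n : nat) : seq bool :=
  mkseq (fun i => odd (n %/ 2 ^ i)) (up_log 2 n.+1).

Definition nat_of_bits (s : seq bool) : nat :=
  foldr (fun (b : bool) v => (b + v.*2)%N) 0%N s.

Lemma bits_of_natK : cancel bits_of_nat nat_of_bits.
Proof.
have H l n : (n < 2 ^ l)%N ->
    nat_of_bits (mkseq (fun i => odd (n %/ 2 ^ i)) l) = n.
  elim: l n => [|l IHl] n; first by rewrite expn0 ltnS leqn0 => /eqP.
  move=> nl; rewrite /mkseq /= expn0 divn1 (iotaDl 1 0) -map_comp.
  rewrite -[RHS]odd_double_half; congr (_ + _.*2)%N.
  rewrite -[RHS]IHl ?ltn_half_double -?mul2n -?expnS//.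
  congr nat_of_bits; apply: eq_map => i /=.
  by rewrite add1n expnS divnMA divn2.
by move=> n; apply: H; exact: (@up_logP 2 n.+1).
Qed.

Definition input (n : nat) : store :=
  fun x => if x == 0%N then bits_of_nat n else [::].

(* [computes_in p n t q]: on input [n], the program [p] halts after [t] bit
   operations with output [q], read off from its sign bit in stack 0, numerator
   in stack 1 and nonzero denominator in stack 2. *)
Definition computes_in (p : prog) (n t : nat) (q : rat) : Prop :=
  exists s : store,
    [/\ exec p (input n) t s,
        nat_of_bits (s 2%N) != 0%N &
        q = (-1) ^+ head false (s 0%N) * (nat_of_bits (s 1%N))%:R
              / (nat_of_bits (s 2%N))%:R].

(* Main.v *)
Require Import Defs.
From mathcomp Require Import all_boot all_order all_algebra.
From mathcomp Require Import all_classical all_reals all_analysis.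
From mathcomp Require Import measurable_realfun.
From mathcomp Require Import zify ring lra.
Import Order.TTheory GRing.Theory Num.Theory.
Import numFieldNormedType.Exports.

(** The integrand is replaced by a polynomial, and polynomials are integrated
    exactly.

    On a compact polytope inside the open orthant every coordinate [x] satisfies
    [0 < a <= x <= M].  With [y = 1 - x / M], the first [2 * K] terms of the
    geometric series for [M / x] have the sum [M / x * (1 - y ^ (2 * K))].  The
    product over the coordinates is a polynomial in [t] that differs from
    [1 / (t_1 ... t_k)] by at most a constant times [rho ^ K], where
    [rho = (1 - a / M) ^ 2 < 1] ([approx_error]).  Hence the error on the integral
    is at most [2 ^ -n] when [K] is a suitable fixed multiple of [n].

    For a fixed polytope, the integral of a polynomial of degree [d] is given by a
    closed formula whose size is polynomial in [d] ([integral_polyhedron]).  By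
    Fourier-Motzkin elimination, the line over a point of the projection along the
    first coordinate meets the polytope in a segment from the largest of finitely
    many affine forms [l] to the smallest of finitely many affine forms [u].  The
    projection splits into finitely many polyhedra on each of which [l] and [u] are
    fixed.  There the integral over the segment is
    [(u - l) * int_0^1 f (l + s * (u - l)) ds], and the integral over [s] equals a
    quadrature formula with the nodes [j / m], [j < m <= D], that is exact for
    degrees below [D] ([quad_segment]).  The outcome is a polynomial in the other
    coordinates, of degree [d + 1], and the elimination goes on.  Unrolled, this
    gives for each of finitely many chambers a nest of [2 * k] sums with at most
    [D = O(n)] terms each, of products of rational numbers ([cubature]).

    Such formulas are evaluated in polynomial time.  An expression built from
    arithmetic operations, and from sums and products over ranges whose lengths are
    polynomially bounded, has a value with polynomially many binary digits; it is
    computed by evaluating the subexpressions one after the other on the stacks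
    with the schoolbook algorithms ([compile_runs]).  The expressions have natural
    numbers as values, and rational numbers are differences of two of them over a
    third, without reduction to lowest terms ([rat_expr_sum]). *)

Set Implicit Arguments.
Unset Strict Implicit.
Unset Printing Implicit Defensive.

(** * Canonical binary expansions *)

Lemma bits_of_nat0 : bits_of_nat 0 = [::].
Proof. by rewrite /bits_of_nat up_log1. Qed.

Lemma bits_of_nat_eq0 n : (bits_of_nat n == [::]) = (n == 0).
Proof.
by apply/eqP/eqP => [e|->]; rewrite ?bits_of_nat0// -[n]bits_of_natK e.
Qed.

Lemma bits_of_nat_double (b : bool) n : 0 < b + n.*2 ->
  bits_of_nat (b + n.*2) = b :: bits_of_nat n.
Proof.
move=> gt0; rewrite /bits_of_nat up_log2S// half_bit_double /mkseq /=.
rewrite expn0 divn1 oddD odd_double addbF oddb (iotaDl 1 0) -map_comp.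
congr (_ :: _); apply: eq_map => i /=.
by rewrite add1n expnS divnMA divn2 half_bit_double.
Qed.

Lemma bits_of_nat1 : bits_of_nat 1 = [:: true].
Proof. by rewrite (@bits_of_nat_double true 0)// bits_of_nat0. Qed.

Lemma canonical_bits s : last true s -> bits_of_nat (nat_of_bits s) = s.
Proof.
elim: s => [|b s IH] /=; first by rewrite bits_of_nat0.
case: s IH => [|c s] IH /= ls.
  by rewrite ls (@bits_of_nat_double true 0)// bits_of_nat0.
have E : bits_of_nat (c + (nat_of_bits s).*2) = c :: s := IH ls.
rewrite bits_of_nat_double ?E//.
by rewrite addn_gt0 double_gt0 [X in _ || X]lt0n -bits_of_nat_eq0 E orbT.
Qed.

Lemma nat_of_bits_cat u v :
  nat_of_bits (u ++ v) = nat_of_bits u + 2 ^ size u * nat_of_bits v.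
Proof. by elim: u => [|b u IH] /=; rewrite ?expn0 ?IH ?expnS; lia. Qed.

Lemma nat_of_bits_lt u : nat_of_bits u < 2 ^ size u.
Proof. by elim: u => [|[] u IH] //=; rewrite expnS; lia. Qed.

Lemma size_bits_of_nat n L : n < 2 ^ L -> size (bits_of_nat n) <= L.
Proof. by move=> nL; rewrite size_mkseq; apply: up_log_min. Qed.

(** * Running programs within a time bound *)

Definition runs (p : prog) (s : store) (T : nat) (s' : store) :=
  exists2 t, t <= T & exec p s t s'.

Lemma runs_le p s T T' s' : T <= T' -> runs p s T s' -> runs p s T' s'.
Proof. by move=> TT' [t tT e]; exists t => //; apply: leq_trans TT'. Qed.

Lemma runs_push b x s : runs (Push b x) s 1 (update s x (b :: s x)).
Proof. by exists 1 => //; constructor. Qed.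

Lemma runs_pop x s : runs (Pop x) s 1 (update s x (behead (s x))).
Proof. by exists 1 => //; constructor. Qed.

Lemma runs_seq p q s s1 s' T1 T2 :
  runs p s T1 s1 -> runs q s1 T2 s' -> runs (Seq p q) s (T1 + T2) s'.
Proof.
by move=> [t1 ? e1] [t2 ? e2]; exists (t1 + t2); [lia|apply: exec_seq e1 e2].
Qed.

Lemma runs_if c p q s T s' :
  runs (if holds c s then p else q) s T s' -> runs (If c p q) s T.+1 s'.
Proof.
case: ifP => [h|/negbT h] [t tT e]; exists t.+1 => //.
  exact: exec_if_true.
exact: exec_if_false.
Qed.

Lemma runs_while_true c p s s1 s' T1 T2 : holds c s ->
  runs p s T1 s1 -> runs (While c p) s1 T2 s' ->
  runs (While c p) s (T1 + T2).+1 s'.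
Proof.
move=> h [t1 ? e1] [t2 ? e2]; exists (t1 + t2).+1; first by lia.
exact: exec_while_true h e1 e2.
Qed.

Lemma runs_while_false c p s : ~~ holds c s -> runs (While c p) s 1 s.
Proof. by move=> h; exists 1 => //; apply: exec_while_false. Qed.

Lemma runs_eq p s T s1 s2 : runs p s T s1 -> s1 =1 s2 -> runs p s T s2.
Proof. by move=> r /funext <-. Qed.

(** Decides pointwise equality of stores built by [update], given the order of
    the stacks as linear (in)equalities. *)
Ltac store_eq :=
  let y := fresh "y" in move=> y; rewrite /update;
  repeat (case: eqP => [?|?]; subst => //=; try lia); try congruence; auto.

Lemma updateE s x v : update s x v x = v.
Proof. by rewrite /update eqxx. Qed.

Lemma updateN s x v y : y <> x -> update s x v y = s y.
Proof. by rewrite /update; case: eqP. Qed.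

Lemma update_id s x : update s x (s x) =1 s.
Proof. by move=> y; rewrite /update; case: eqP => [->|]. Qed.

Lemma updateK s x u v : update (update s x u) x v =1 update s x v.
Proof. by move=> y; rewrite /update; case: eqP. Qed.

(** * Elementary programs on stacks *)

Definition clear x := While (Nonempty x) (Pop x).

Lemma runs_clear x s :
  runs (clear x) s (size (s x)).*2.+1 (update s x [::]).
Proof.
move: {2}(s x) (erefl (s x)) => v; elim: v s => [|b v IH] s sx.
  rewrite sx; apply: runs_le (leqnn _) _.
  apply: runs_eq (runs_while_false _ _) _ => /=; first by rewrite sx.
  by rewrite -sx => y; rewrite update_id.
have h : holds (Nonempty x) s by rewrite /= sx.
have R := runs_pop x s; rewrite sx /= in R.
apply: runs_eq (runs_le _ (runs_while_true h R (IH _ (updateE _ _ _)))) _.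
  by rewrite updateE sx /=; lia.
by store_eq.
Qed.

Definition move_rev a d :=
  While (Nonempty a) (If (Top a) (Seq (Push true d) (Pop a))
                                 (Seq (Push false d) (Pop a))).

Lemma runs_move_rev a d s : a <> d ->
  runs (move_rev a d) s (4 * size (s a)).+1
       (update (update s a [::]) d (catrev (s a) (s d))).
Proof.
move=> ad; move: {2}(s a) (erefl (s a)) => v; elim: v s => [|b v IH] s sa.
  rewrite sa /=; apply: runs_eq (runs_while_false _ _) _ => /=.
    by rewrite sa.
  by store_eq.
rewrite sa /=.
have step : runs (If (Top a) (Seq (Push true d) (Pop a))
    (Seq (Push false d) (Pop a))) s 3 (update (update s d (b :: s d)) a v).
  apply: runs_if; rewrite /= sa /=.
  case: b {sa} (sa) => sa; (apply: (@runs_eq _ _ (1 + 1));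
    [by apply: runs_seq; [exact: runs_push|exact: runs_pop]|]);
  by rewrite (updateN _ _ ad) sa.
have h : holds (Nonempty a) s by rewrite /= sa.
apply: runs_eq (runs_le _ (runs_while_true h step (IH _ (updateE _ _ _)))) _.
  by rewrite updateE; lia.
by store_eq.
Qed.

(** Copies [x] onto the empty stack [y] with the help of the empty stack [z]. *)
Definition copy x y z := Seq (move_rev x z)
  (While (Nonempty z)
    (If (Top z) (Seq (Pop z) (Seq (Push true x) (Push true y)))
                (Seq (Pop z) (Seq (Push false x) (Push false y))))).

Lemma runs_copy x y z s : x <> y -> x <> z -> y <> z ->
  s y = [::] -> s z = [::] ->
  runs (copy x y z) s (9 * size (s x)).+2 (update s y (s x)).
Proof.
move=> xy xz yz sy sz.
rewrite /copy; set loop := While _ _.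
have H v s0 : s0 z = v -> runs loop s0 (5 * size v).+1
   (update (update (update s0 x (catrev v (s0 x))) y (catrev v (s0 y))) z [::]).
  elim: v s0 => [|b v IH] s0 s0z.
    rewrite muln0; apply: runs_eq; first by apply: runs_while_false; rewrite /= s0z.
    by store_eq.
  have h : holds (Nonempty z) s0 by rewrite /= s0z.
  have step : runs (If (Top z) (Seq (Pop z) (Seq (Push true x) (Push true y)))
                (Seq (Pop z) (Seq (Push false x) (Push false y)))) s0 4
     (update (update (update s0 z v) x (b :: s0 x)) y (b :: s0 y)).
    apply: runs_if; rewrite /= s0z /=.
    case: b {h} s0z => s0z; (apply: (@runs_eq _ _ (1 + (1 + 1)));
      [by apply: runs_seq; [exact: runs_pop|apply: runs_seq; exact: runs_push]|]);
    by rewrite s0z /=; store_eq.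
  apply: runs_eq (runs_le _ (runs_while_true h step (IH _ _))) _.
  - by rewrite /=; lia.
  - by rewrite 2?updateN ?updateE; congruence.
  - by rewrite /=; store_eq.
have R1 := runs_move_rev s xz.
have R2 := H _ _ (updateE (update s x [::]) z (catrev (s x) (s z))).
apply: runs_eq (runs_le _ (runs_seq R1 R2)) _.
  by rewrite sz catrevE size_cat size_rev /=; lia.
rewrite sz; store_eq.
- by rewrite sy !catrevE !cats0 revK.
- by rewrite !catrevE !cats0 revK.
Qed.

(** The stack [a] holds digits with the most significant one on top; they go to
    the empty stack [d] without leading zeros.  Normalizing every result makes the
    length of a stack a function of the number on it, so that bounds on values are
    bounds on time. *)
Definition normalize a d :=
  While (Nonempty a)
    (If (Top a) (Seq (Push true d) (Seq (Pop a) (move_rev a d))) (Pop a)).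

Lemma runs_normalize a d s : a <> d -> s d = [::] ->
  runs (normalize a d) s (6 * size (s a)).+2
    (update (update s a [::]) d (bits_of_nat (nat_of_bits (rev (s a))))).
Proof.
move=> ad; move: {2}(s a) (erefl (s a)) => v; elim: v s => [|b v IH] s sa sd.
  rewrite sa bits_of_nat0; apply: runs_le (leqnSn _) _.
  apply: runs_eq (runs_while_false _ _) _ => /=; first by rewrite sa.
  by store_eq.
have h : holds (Nonempty a) s by rewrite /= sa.
rewrite sa; case: b sa => sa.
  have step : runs (If (Top a) (Seq (Push true d) (Seq (Pop a) (move_rev a d)))
      (Pop a)) s (4 * size v + 4)
      (update (update s a [::]) d (rcons (rev v) true)).
    apply: runs_le; last first.
      apply: runs_if; rewrite /= sa /=; apply: runs_eq.
        apply: runs_seq (runs_push _ _ _) (runs_seq (runs_pop _ _) _).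
        exact: runs_move_rev.
      store_eq; rewrite sa sd /= catrevE; exact: cats1.
    by rewrite updateE updateN// sa /=; lia.
  apply: runs_eq (runs_le _ (runs_while_true h step (runs_while_false _ _))) _.
  - by rewrite /=; lia.
  - by rewrite /= updateN// updateE.
  - by rewrite rev_cons canonical_bits ?last_rcons.
have step : runs (If (Top a) (Seq (Push true d) (Seq (Pop a) (move_rev a d)))
    (Pop a)) s 2 (update s a v).
  by apply: runs_if; rewrite /= sa /=; have := runs_pop a s; rewrite sa.
have R : runs _ _ _ _ := IH (update s a v) (updateE _ _ _) (etrans (updateN _ _ _) sd).
apply: runs_eq (runs_le _ (runs_while_true h step (R _))) _.
- by rewrite updateE /=; lia.
- by congruence.
rewrite updateE rev_cons -cats1 nat_of_bits_cat /= muln0 addn0; store_eq.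
Qed.

(** * Addition, truncated subtraction and multiplication *)

Definition branch x (k : bool -> prog) := If (Top x) (k true) (k false).

Lemma runs_branch x k s T s' :
  runs (k (head false (s x))) s T s' -> runs (branch x k) s T.+1 s'.
Proof. by move=> r; apply: runs_if => /=; case: ifP r. Qed.

(** One position of the schoolbook algorithm: the digit goes to [o], and [c]
    holds the carry or borrow, which is [f] of the two digits and the old one. *)
Definition ripple_step (f : bool -> bool -> bool -> bool) a b c o :=
  branch a (fun x => branch b (fun y => branch c (fun w =>
    Seq (Pop a) (Seq (Pop b) (Seq (Pop c)
      (Seq (Push (f x y w) c) (Push (x (+) y (+) w) o))))))).

Definition ripple_store (s : store) a b c o u v w r : store :=
  update (update (update (update s a u) b v) c [:: w]) o r.

Lemma runs_ripple_step f a b c o s u v w r :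
  uniq [:: a; b; c; o] ->
  runs (ripple_step f a b c o) (ripple_store s a b c o u v w r) 8
    (ripple_store s a b c o (behead u) (behead v)
      (f (head false u) (head false v) w)
      (head false u (+) head false v (+) w :: r)).
Proof.
rewrite /= !inE !negb_or => /and4P[/and3P[/eqP ab /eqP ac /eqP ao]].
move=> /andP[/eqP bc /eqP bo] /eqP co _.
rewrite /ripple_store; apply: runs_eq.
  apply: runs_branch; apply: runs_branch; apply: runs_branch.
  apply: runs_seq (runs_pop _ _) (runs_seq (runs_pop _ _) (runs_seq
    (runs_pop _ _) (runs_seq (runs_push _ _ _) (runs_push _ _ _)))).
rewrite 3?updateN ?updateE; [|congruence..].
rewrite 2?updateN ?updateE; [|congruence..].
rewrite 1?updateN ?updateE; [|congruence..].
store_eq.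
Qed.

(** The invariant of the schoolbook algorithm: [q] lists the digits produced so
    far, the other summand is what the remaining digits still stand for.  Addition
    is [eps = 1], subtraction [eps = -1]. *)
Lemma runs_ripple (eps : int) (f : bool -> bool -> bool -> bool) (isa : bool)
    (a b c o : nat) (s : store) (u v : seq bool) (w : bool) (r : seq bool) :
  (forall x y w : bool, x%:Z + eps * (y%:Z + w%:Z) =
     (x (+) y (+) w)%:Z + 2 * eps * (f x y w)%:Z)%R ->
  uniq [:: a; b; c; o] ->
  exists w' q, let n := size (if isa then u else v) in
  [/\ runs (While (Nonempty (if isa then a else b)) (ripple_step f a b c o))
        (ripple_store s a b c o u v w r) (9 * n).+1
        (ripple_store s a b c o (drop n u) (drop n v) w' (catrev q r)),
      size q = n &
      ((nat_of_bits u)%:Z + eps * ((nat_of_bits v)%:Z + w%:Z) =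
       (nat_of_bits q)%:Z + (2 ^ n)%N%:Z * ((nat_of_bits (drop n u))%:Z +
       eps * ((nat_of_bits (drop n v))%:Z + w'%:Z)))%R].
Proof.
move=> hf U; have := U; rewrite /= !inE !negb_or.
move=> /and4P[/and3P[/eqP ab /eqP ac /eqP ao]].
move=> /andP[/eqP bc /eqP bo] /eqP co _.
move sz : (size (if isa then u else v)) => n.
elim: n u v w r sz => [|n IH] u v w r sz; cbv zeta.
  exists w, [::]; rewrite !drop0 /=; split => //; last first.
    by rewrite expn0 mul1r add0r.
  apply: runs_while_false; rewrite /= negbK /ripple_store.
  case: isa sz => /eqP; rewrite size_eq0 => /eqP ->.
    by rewrite 3?updateN ?updateE.
  by rewrite 2?updateN ?updateE.
have szb : size (if isa then behead u else behead v) = n.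
  by case: (isa) sz; rewrite size_behead => ->.
have [w' [q [R sq inv]]] := IH _ _ (f (head false u) (head false v) w)
  (head false u (+) head false v (+) w :: r) szb.
have dropS m (z : seq bool) : drop m.+1 z = drop m (behead z) by case: z.
exists w', (head false u (+) head false v (+) w :: q); split.
- have h : holds (Nonempty (if isa then a else b))
      (ripple_store s a b c o u v w r).
    rewrite /ripple_store /=; case: (isa) sz.
      by rewrite 3?updateN ?updateE//; case: (u).
    by rewrite 2?updateN ?updateE//; case: (v).
  rewrite 2!dropS; apply: runs_le (runs_while_true h (runs_ripple_step _ _ _ _ _ _ U) R).
  by lia.
- by rewrite /= sq.
- rewrite 2!dropS expnS.
  have nE (z : seq bool) :
      nat_of_bits z = head false z + (nat_of_bits (behead z)).*2 by case: z.
  rewrite (nE u) (nE v) [nat_of_bits (_ :: _)]/=.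
  move: inv (hf (head false u) (head false v) w).
  move: (nat_of_bits (behead u)) (nat_of_bits (behead v)) (nat_of_bits q).
  move: (nat_of_bits (drop _ _)) (nat_of_bits (drop _ _)) => A B C D E inv h.
  by move: (2 ^ n) inv => p inv; lia.
Qed.

Definition majority (x y w : bool) := x && y || w && (x || y).

(** [a] becomes [a + b] or [a - b] (truncated); [b] is emptied.  The stacks from
    [z] on serve as scratch. *)
Definition add_prog a b z :=
  let step := ripple_step majority a b z z.+1 in
  Seq (Push false z) (Seq (While (Nonempty a) step) (Seq (While (Nonempty b) step)
    (Seq (If (Top z) (Push true z.+1) (Seq (Push true z) (Pop z)))
         (Seq (Pop z) (normalize z.+1 a))))).

Definition sub_prog a b z :=
  let step := ripple_step (fun x => majority (~~ x)) a b z z.+1 in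
  Seq (Push false z) (Seq (While (Nonempty a) step) (Seq (While (Nonempty b) step)
    (Seq (If (Top z) (clear z.+1) (Seq (Push true z) (Pop z)))
         (Seq (Pop z) (normalize z.+1 a))))).

Lemma runs_ripple_both (eps : int) (f : bool -> bool -> bool -> bool)
    (a b z : nat) (s : store) :
  (forall x y w : bool, x%:Z + eps * (y%:Z + w%:Z) =
     (x (+) y (+) w)%:Z + 2 * eps * (f x y w)%:Z)%R ->
  a <> b -> a < z -> b < z -> s z = [::] -> s z.+1 = [::] ->
  let step := ripple_step f a b z z.+1 in
  exists (w : bool) q,
  [/\ forall p T s', runs p (ripple_store s a b z z.+1 [::] [::] w (rev q)) T s' ->
        runs (Seq (Push false z) (Seq (While (Nonempty a) step)
               (Seq (While (Nonempty b) step) p))) s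
          (9 * (size (s a) + size (s b)) + 3 + T) s',
      size q <= size (s a) + size (s b) &
      ((nat_of_bits (s a))%:Z + eps * (nat_of_bits (s b))%:Z =
       (nat_of_bits q)%:Z + eps * (2 ^ size q)%N%:Z * w%:Z)%R].
Proof.
move=> hf ab az bz sz sz1 step.
have U : uniq [:: a; b; z; z.+1].
  by rewrite /= !inE !negb_or; apply/and4P; split => //; lia.
have [w1 [q1 [R1 sq1 inv1]]] :=
  runs_ripple true s (s a) (s b) false [::] hf U.
have [w2 [q2 [R2 sq2 inv2]]] :=
  runs_ripple false s (drop (size (s a)) (s a)) (drop (size (s a)) (s b)) w1
    (catrev q1 [::]) hf U.
rewrite /= in R1 sq1 inv1 R2 sq2 inv2.
have dropnil n : drop n ([::] : seq bool) = [::] by case: n.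
rewrite drop_size in R1; rewrite !drop_size dropnil in R2 inv2.
have R0 : runs (Push false z) s 1 (ripple_store s a b z z.+1 (s a) (s b) false [::]).
  by apply: runs_eq (runs_push _ _ _) _; rewrite sz /ripple_store; store_eq.
exists w2, (q1 ++ q2); split.
- move=> p T s' Rp; rewrite /step; apply: runs_le (runs_seq R0 (runs_seq R1 (runs_seq R2 _))).
    by rewrite size_drop; shelve.
  have -> : catrev q2 (catrev q1 [::]) = rev (q1 ++ q2).
    by rewrite rev_cat !catrevE cats0.
  exact: Rp.
- by rewrite size_cat sq1 sq2 size_drop; lia.
- rewrite nat_of_bits_cat size_cat expnD sq1 sq2.
  move: inv1 inv2; rewrite drop_size [nat_of_bits [::]]/=.
  move: (2 ^ _) (2 ^ _) (nat_of_bits _) (nat_of_bits (drop _ _)) => P1 P2 A B.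
  move: (nat_of_bits (s b)) (nat_of_bits q1) (nat_of_bits q2) => C D E inv1 inv2.
  by nia.
Unshelve. by lia.
Qed.

Lemma runs_add a b z s : a <> b -> a < z -> b < z ->
  s z = [::] -> s z.+1 = [::] ->
  runs (add_prog a b z) s (20 * (size (s a) + size (s b)) + 20)
    (update (update s b [::]) a
       (bits_of_nat (nat_of_bits (s a) + nat_of_bits (s b)))).
Proof.
move=> ab az bz sz sz1.
have hf (x y w : bool) : (x%:Z + 1 * (y%:Z + w%:Z) =
     (x (+) y (+) w)%:Z + 2 * 1 * (majority x y w)%:Z)%R.
  by case: x; case: y; case: w.
have [w [q [R sq inv]]] := runs_ripple_both hf ab az bz sz sz1.
have step : runs (If (Top z) (Push true z.+1) (Seq (Push true z) (Pop z)))
    (ripple_store s a b z z.+1 [::] [::] w (rev q)) 3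
    (ripple_store s a b z z.+1 [::] [::] w (rev (q ++ nseq w true))).
  apply: runs_if; rewrite /= /ripple_store updateN ?updateE /=; last by lia.
  case: w {inv R} => /=.
    apply: runs_eq (runs_le _ (runs_push _ _ _)) _ => //.
    rewrite /ripple_store updateE rev_cat; store_eq.
  apply: runs_eq (runs_seq (runs_push _ _ _) (runs_pop _ _)) _.
  rewrite cats0 /ripple_store; store_eq.
apply: runs_eq (runs_le _ (R _ _ _ (runs_seq step (runs_seq (runs_pop _ _)
   (runs_normalize _ _))))) _.
- rewrite /ripple_store updateN ?updateE; last by lia.
  by rewrite size_rev size_cat size_nseq; case: (w); lia.
- by lia.
- by rewrite /ripple_store 4?updateN ?updateE//; lia.
move: inv; rewrite mul1r !mul1r => inv.
have -> : nat_of_bits (s a) + nat_of_bits (s b) = nat_of_bits (q ++ nseq w true).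
  rewrite nat_of_bits_cat; case: (w) inv => /=; lia.
rewrite /ripple_store; store_eq.
by rewrite revK.
Qed.

Lemma runs_sub a b z s : a <> b -> a < z -> b < z ->
  s z = [::] -> s z.+1 = [::] ->
  runs (sub_prog a b z) s (20 * (size (s a) + size (s b)) + 20)
    (update (update s b [::]) a
       (bits_of_nat (nat_of_bits (s a) - nat_of_bits (s b)))).
Proof.
move=> ab az bz sz sz1.
have hf (x y w : bool) : (x%:Z + -1 * (y%:Z + w%:Z) =
     (x (+) y (+) w)%:Z + 2 * -1 * (majority (~~ x) y w)%:Z)%R.
  by case: x; case: y; case: w.
have [w [q [R sq inv]]] := runs_ripple_both hf ab az bz sz sz1.
have step : runs (If (Top z) (clear z.+1) (Seq (Push true z) (Pop z)))
    (ripple_store s a b z z.+1 [::] [::] w (rev q)) ((size q).*2 + 3)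
    (ripple_store s a b z z.+1 [::] [::] w (rev (if w then [::] else q))).
  apply: runs_le; last first.
    apply: runs_if; rewrite /= /ripple_store updateN ?updateE /=; last by lia.
    instantiate (1 := (size q).*2.+1.+1).
    case: w {inv R} => /=.
      apply: runs_eq (runs_le _ (runs_clear _ _)) _ => //.
        by rewrite /ripple_store updateE size_rev; lia.
      rewrite /ripple_store; store_eq.
    apply: runs_eq (runs_le _ (runs_seq (runs_push _ _ _) (runs_pop _ _))) _.
      by lia.
    rewrite /ripple_store; store_eq.
  by lia.
apply: runs_eq (runs_le _ (R _ _ _ (runs_seq step (runs_seq (runs_pop _ _)
   (runs_normalize _ _))))) _.
- rewrite /ripple_store updateN ?updateE; last by lia.
  by rewrite size_rev; case: (w) => /=; lia.
- by lia.
- by rewrite /ripple_store 4?updateN ?updateE//; lia.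
have -> : nat_of_bits (s a) - nat_of_bits (s b) = nat_of_bits (if w then [::] else q).
  have := nat_of_bits_lt q.
  case: (w) inv => /=; move: (2 ^ _) => P; lia.
rewrite /ripple_store; store_eq.
by rewrite revK.
Qed.

(** [a] becomes [a * b] by Horner's scheme on the digits of [a], the most
    significant first; [b] is emptied. *)
Definition mul_step a b z :=
  Seq (If (Nonempty a) (Push false a) (Pop a))
    (branch z (fun d => if d then
       Seq (Pop z) (Seq (copy b z.+1 z.+2) (add_prog a z.+1 z.+2)) else Pop z)).

Definition mul_prog a b z :=
  Seq (move_rev a z) (Seq (While (Nonempty z) (mul_step a b z)) (clear b)).

Lemma runs_mul_step a b z s A y (d : bool) w M : a <> b -> a < z -> b < z ->
  (forall i, z < i -> s i = [::]) ->
  s z = d :: w -> s a = bits_of_nat A -> s b = bits_of_nat y ->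
  A.*2 < 2 ^ M -> y < 2 ^ M ->
  runs (mul_step a b z) s (49 * M + 30)
    (update (update s z w) a (bits_of_nat (A.*2 + d * y))).
Proof.
move=> ab az bz s0 sz sa sb AM yM.
have R1 : runs (If (Nonempty a) (Push false a) (Pop a)) s 2
    (update s a (bits_of_nat A.*2)).
  apply: runs_if; rewrite /= sa bits_of_nat_eq0.
  case: A {AM} sa => [|A] sa /=.
    by apply: runs_eq (runs_pop _ _) _; rewrite sa double0 bits_of_nat0.
  apply: runs_eq (runs_push _ _ _) _.
  by rewrite sa -[A.+1.*2]add0n -(@bits_of_nat_double false).
apply: runs_le (runs_seq R1 (runs_branch (T := 49 * M + 27) _)); first by lia.
rewrite updateN ?sz /=; last by lia.
have sz' : update s a (bits_of_nat A.*2) z = d :: w by rewrite updateN//; lia.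
case: d {sz} sz' => sz' /=; last first.
  apply: runs_eq (runs_le _ (runs_pop _ _)) _; first by lia.
  rewrite addn0 sz' /=; store_eq.
have sA := size_bits_of_nat AM; have sy := size_bits_of_nat yM.
set s2 := update (update s a (bits_of_nat A.*2)) z w.
have R2 : runs (Pop z) (update s a (bits_of_nat A.*2)) 1 s2.
  by apply: runs_eq (runs_pop _ _) _; rewrite sz'.
have s2a : s2 a = bits_of_nat A.*2 by rewrite /s2 updateN ?updateE//; lia.
have s2b : s2 b = bits_of_nat y by rewrite /s2 2?updateN//; lia.
have s20 i : z < i -> s2 i = [::] by move=> zi; rewrite /s2 2?updateN ?s0//; lia.
have R3 : runs (copy b z.+1 z.+2) s2 (9 * M + 2) (update s2 z.+1 (bits_of_nat y)).
  apply: runs_eq (runs_le _ (runs_copy _ _ _ _ _)) _; rewrite ?s2b ?s20//; lia.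
have [ab' ab''] : a <> z.+1 /\ a < z.+2 by lia.
have R4 := @runs_add a z.+1 z.+2 (update s2 z.+1 (bits_of_nat y)) ab' ab'' (leqnn _).
have E : update s2 z.+1 (bits_of_nat y) a = bits_of_nat A.*2 by rewrite updateN.
rewrite updateE E !bits_of_natK in R4.
apply: runs_eq (runs_le _ (runs_seq R2 (runs_seq R3 (R4 _ _)))) _.
- by lia.
- by rewrite updateN ?s20//; lia.
- by rewrite updateN ?s20//; lia.
rewrite mul1n /s2; store_eq.
by rewrite s0.
Qed.

Lemma runs_mul_loop a b z s A y w M : a <> b -> a < z -> b < z ->
  (forall i, z < i -> s i = [::]) ->
  s z = w -> s a = bits_of_nat A -> s b = bits_of_nat y ->
  A * 2 ^ size w + nat_of_bits (rev w) * y < 2 ^ M -> y < 2 ^ M ->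
  runs (While (Nonempty z) (mul_step a b z)) s (size w * (49 * M + 31) + 1)
    (update (update s z [::]) a
      (bits_of_nat (A * 2 ^ size w + nat_of_bits (rev w) * y))).
Proof.
move=> ab az bz.
elim: w s A => [|d w IH] s A s0 sz sa sb AM yM.
  apply: runs_eq; first by apply: runs_while_false; rewrite /= sz.
  by rewrite /= muln1 addn0; store_eq.
have h : holds (Nonempty z) s by rewrite /= sz.
have E : A * 2 ^ (size w).+1 + nat_of_bits (rev (d :: w)) * y =
    (A.*2 + d * y) * 2 ^ size w + nat_of_bits (rev w) * y.
  rewrite rev_cons -cats1 nat_of_bits_cat size_rev expnS /=.
  by case: d {sz AM}; lia.
rewrite /= E in AM *.
have p2 : 0 < 2 ^ size w by rewrite expn_gt0.
have AM2 : A.*2 < 2 ^ M by apply: leq_ltn_trans AM; nia.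
have R1 := runs_mul_step ab az bz s0 sz sa sb AM2 yM.
have R2 : runs _ _ _ _ := IH _ (A.*2 + d * y) _ _ (updateE _ _ _) _ AM yM.
apply: runs_eq (runs_le _ (runs_while_true h R1 (R2 _ _ _ _))) _.
- by lia.
- by move=> i zi; rewrite 2?updateN ?s0//; lia.
- by rewrite updateN ?updateE//; lia.
- by rewrite 2?updateN//; lia.
by store_eq.
Qed.

Lemma runs_mul a b z s x y L : a <> b -> a < z -> b < z ->
  (forall i, z <= i -> s i = [::]) ->
  s a = bits_of_nat x -> s b = bits_of_nat y -> x < 2 ^ L -> y < 2 ^ L ->
  runs (mul_prog a b z) s (200 * (L * L) + 200)
    (update (update s b [::]) a (bits_of_nat (x * y))).
Proof.
move=> ab az bz s0 sa sb xL yL.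
have sx := size_bits_of_nat xL; have sy := size_bits_of_nat yL.
have xyM : 0 * 2 ^ size (rev (s a)) + nat_of_bits (rev (rev (s a))) * y < 2 ^ (L + L).
  by rewrite mul0n add0n revK sa bits_of_natK expnD ltn_mul.
have yM : y < 2 ^ (L + L).
  by apply: leq_trans yL _; rewrite leq_exp2l// leq_addr.
have az' : a <> z by lia.
have R1 : runs (move_rev a z) s (4 * L).+1 (update (update s a [::]) z (rev (s a))).
  apply: runs_eq (runs_le _ (runs_move_rev s az')) _; first by rewrite sa; lia.
  by move=> i; rewrite (s0 z (leqnn z)).
apply: runs_eq (runs_le _ (runs_seq R1 (runs_seq (runs_mul_loop ab az bz
  _ (updateE _ _ _) _ _ xyM yM) (runs_clear _ _)))) _.
- rewrite 4?updateN ?updateE ?sb ?size_rev ?sa; [|lia..].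
  nia.
- by move=> i zi; rewrite 2?updateN ?s0//; lia.
- by rewrite updateN ?updateE ?bits_of_nat0//; lia.
- by rewrite 2?updateN//; lia.
rewrite mul0n add0n revK sa bits_of_natK; store_eq.
by rewrite s0.
Qed.

(** * A language of arithmetic expressions *)

Inductive binop := OpAdd | OpSub | OpMul.

Definition binop_nat o : nat -> nat -> nat :=
  match o with OpAdd => addn | OpSub => subn | OpMul => muln end.

Definition binop_prog o : nat -> nat -> nat -> prog :=
  match o with OpAdd => add_prog | OpSub => sub_prog | OpMul => mul_prog end.

Lemma runs_binop o a b z s x y L : a <> b -> a < z -> b < z ->
  (forall i, z <= i -> s i = [::]) ->
  s a = bits_of_nat x -> s b = bits_of_nat y -> x < 2 ^ L -> y < 2 ^ L ->
  runs (binop_prog o a b z) s (200 * (L * L) + 200)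
    (update (update s b [::]) a (bits_of_nat (binop_nat o x y))).
Proof.
move=> ab az bz s0 sa sb xL yL.
have sx := size_bits_of_nat xL; have sy := size_bits_of_nat yL.
have Z : s z = [::] by apply: s0.
have Z1 : s z.+1 = [::] by apply: s0; lia.
case: o => /=; last exact: runs_mul.
  apply: runs_eq (runs_le _ (runs_add ab az bz Z Z1)) _.
    by rewrite sa sb; nia.
  by rewrite sa sb !bits_of_natK.
apply: runs_eq (runs_le _ (runs_sub ab az bz Z Z1)) _.
  by rewrite sa sb; nia.
by rewrite sa sb !bits_of_natK.
Qed.

(** In [Big o c i b e] the variable [i] of [e] runs from [0] to [b - 1], and the
    values of [e] are accumulated with [o], starting from [c]. *)
Inductive expr :=
  | Cst (c : nat)
  | Var (i : nat)
  | Bin (o : binop) (e1 e2 : expr)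
  | Big (o : binop) (c i : nat) (b e : expr).

Definition bind (env : nat -> nat) i y : nat -> nat :=
  fun j => if j == i then y else env j.

Fixpoint eval_expr (env : nat -> nat) e : nat :=
  match e with
  | Cst c => c
  | Var i => env i
  | Bin o e1 e2 => binop_nat o (eval_expr env e1) (eval_expr env e2)
  | Big o c i b e =>
      iteri (eval_expr env b) (fun y v => binop_nat o v (eval_expr (bind env i y) e)) c
  end.

Fixpoint loop_free e :=
  match e with
  | Cst _ | Var _ => true
  | Bin _ e1 e2 => loop_free e1 && loop_free e2
  | Big _ _ _ _ _ => false
  end.

(** Loop-free expressions are polynomially bounded; requiring this of the numbers
    of iterations is what keeps every evaluation polynomial. *)
Fixpoint admissible e :=
  match e with
  | Cst _ | Var _ => true
  | Bin _ e1 e2 => admissible e1 && admissible e2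
  | Big _ _ _ b e => loop_free b && admissible e
  end.

Lemma loop_free_admissible e : loop_free e -> admissible e.
Proof. by elim: e => //= o e1 IH1 e2 IH2 /andP[/IH1-> /IH2->]. Qed.

Fixpoint push_bits x (v : seq bool) :=
  if v is b :: v' then Seq (push_bits x v') (Push b x)
  else Seq (Push true x) (Pop x).

Lemma runs_push_bits x v s : s x = [::] ->
  runs (push_bits x v) s (size v + 2) (update s x v).
Proof.
move=> sx; elim: v => [|b v IH] /=.
  apply: runs_eq (runs_seq (runs_push _ _ _) (runs_pop _ _)) _.
  by rewrite sx; store_eq.
apply: runs_eq (runs_le _ (runs_seq IH (runs_push _ _ _))) _; first by lia.
by rewrite updateE; exact: updateK.
Qed.

(** The value of [e] is left on the stack [r]; the variable [i] is on the stack
    [rho i], below [r], and the stacks above [r] serve as scratch. *)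
Fixpoint compile (rho : nat -> nat) r e : prog :=
  match e with
  | Cst c => push_bits r (bits_of_nat c)
  | Var i => copy (rho i) r r.+1
  | Bin o e1 e2 =>
      Seq (compile rho r e1) (Seq (compile rho r.+1 e2)
        (binop_prog o r r.+1 r.+2))
  | Big o c i b e =>
      let body := Seq (compile (bind rho i r.+2) r.+3 e)
        (Seq (binop_prog o r r.+3 r.+4)
        (Seq (Push true r.+3) (Seq (add_prog r.+2 r.+3 r.+4)
        (Seq (Push true r.+3) (sub_prog r.+1 r.+3 r.+4))))) in
      Seq (push_bits r (bits_of_nat c)) (Seq (compile rho r.+1 b)
        (Seq (While (Nonempty r.+1) body) (clear r.+2)))
  end.

Definition poly_bounded (f : nat -> nat) :=
  exists c, forall X, f X <= (X + 2) ^ c.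

Lemma leq_exp_base m n c : m <= n -> m ^ c <= n ^ c.
Proof. by case: c => // c mn; rewrite leq_exp2r. Qed.

Lemma leq_exp_poly c d X : c <= d -> (X + 2) ^ c <= (X + 2) ^ d.
Proof. by move=> cd; rewrite leq_exp2l// addn2. Qed.

Lemma poly_bounded_const c : poly_bounded (fun=> c).
Proof.
exists c => X; apply: leq_trans (ltnW (ltn_expl c (isT : 1 < 2))) _.
by apply: leq_exp_base; rewrite leq_addl.
Qed.

Lemma poly_bounded_id : poly_bounded id.
Proof. by exists 1 => X; rewrite expn1 leq_addr. Qed.

Lemma poly_bounded_add f g :
  poly_bounded f -> poly_bounded g -> poly_bounded (fun X => f X + g X).
Proof.
move=> [c fc] [d gd]; exists (c + d).+1 => X; rewrite expnS.
have := leq_trans (fc X) (leq_exp_poly X (leq_addr d c)).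
have := leq_trans (gd X) (leq_exp_poly X (leq_addl c d)).
by move: (_ ^ _) => P; nia.
Qed.

Lemma poly_bounded_mul f g :
  poly_bounded f -> poly_bounded g -> poly_bounded (fun X => f X * g X).
Proof.
by move=> [c fc] [d gd]; exists (c + d) => X; rewrite expnD leq_mul.
Qed.

Lemma poly_bounded_comp f g :
  poly_bounded f -> poly_bounded g -> poly_bounded (fun X => f (g X)).
Proof.
move=> [c fc] [d gd]; exists (d.+2 * c) => X; rewrite expnM.
apply: leq_trans (fc _) (leq_exp_base _ _).
have := gd X; rewrite 2!expnS; have : 0 < (X + 2) ^ d by rewrite expn_gt0 addn2.
by move: (_ ^ d) => P; nia.
Qed.

Lemma loop_free_bound e : loop_free e -> exists2 f, poly_bounded f &
  forall env X, (forall i, env i <= X) -> eval_expr env e <= f X.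
Proof.
elim: e => [c|i|o e1 IH1 e2 IH2|//] /=.
- by exists (fun=> c) => //; exact: poly_bounded_const.
- by exists id => //; exact: poly_bounded_id.
move=> /andP[/IH1 [f pf fe] /IH2 [g pg ge]].
exists (fun X => f X + g X + f X * g X).
  exact: poly_bounded_add (poly_bounded_add pf pg) (poly_bounded_mul pf pg).
move=> env X le; have := fe _ _ le; have := ge _ _ le.
by case: o => /=; nia.
Qed.

Lemma binop_lt o x y A B : x < 2 ^ A -> y < 2 ^ B ->
  binop_nat o x y < 2 ^ (A + B).+1.
Proof.
have pA : 0 < 2 ^ A by rewrite expn_gt0.
have pB : 0 < 2 ^ B by rewrite expn_gt0.
by rewrite expnS expnD; case: o => /=; nia.
Qed.

Lemma bind_le env i y X Y :
  (forall j, env j <= X) -> y <= Y -> forall j, bind env i y j <= X + Y.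
Proof. by move=> eX yY j; rewrite /bind; case: eqP => _; [|have := eX j]; lia. Qed.

Lemma iteri_binop_lt o c N (v : nat -> nat) E k : (forall y, y < N -> v y < 2 ^ E) ->
  k <= N -> iteri k (fun y a => binop_nat o a (v y)) c < 2 ^ (c + k * E.+1).
Proof.
move=> vE; elim: k => [_|k IH kN] /=; first by rewrite addn0 ltn_expl.
apply: leq_trans (binop_lt o (IH (ltnW kN)) (vE _ kN)) _.
by rewrite leq_exp2l//; lia.
Qed.

(** The bound is on the number of digits.  A step of a loop increases it by at most
    that of the new term plus one, and the number of steps is polynomially
    bounded. *)
Lemma admissible_bound e : admissible e -> exists2 f, poly_bounded f &
  forall env X, (forall i, env i <= X) -> eval_expr env e < 2 ^ f X.
Proof.
elim: e => [c|i|o e1 IH1 e2 IH2|o c i b _ e IH] /=.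
- exists (fun=> c); first exact: poly_bounded_const.
  by move=> *; rewrite ltn_expl.
- exists id; first exact: poly_bounded_id.
  by move=> env X /(_ i) le; apply: leq_ltn_trans le _; rewrite ltn_expl.
- move=> /andP[/IH1 [f pf fe] /IH2 [g pg ge]].
  exists (fun X => f X + g X + 1).
    exact: poly_bounded_add (poly_bounded_add pf pg) (poly_bounded_const 1).
  by move=> env X le; rewrite addn1; apply: binop_lt; [exact: fe|exact: ge].
move=> /andP[/loop_free_bound [f pf fe] /IH [g pg ge]].
exists (fun X => c + f X * (g (X + f X) + 1)).
  apply: poly_bounded_add (poly_bounded_const c) (poly_bounded_mul pf _).
  apply: poly_bounded_add (poly_bounded_const 1).
  exact: poly_bounded_comp pg (poly_bounded_add poly_bounded_id pf).
move=> env X le; have fb := fe _ _ le; rewrite addn1.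
apply: leq_trans (iteri_binop_lt (N := eval_expr env b) o c (E := g (X + f X)) _ (leqnn _)) _.
  move=> y yN; apply: ge; apply: bind_le => //.
  exact: leq_trans (ltnW yN) fb.
by rewrite leq_exp2l// leq_add2l leq_mul.
Qed.

(** In a loop the stack [r] holds the accumulated value, [r.+1] the number of steps
    still to be made, [r.+2] the loop variable and [r.+3] the new term.  Since the
    range of the loop variable is polynomially bounded, so is the time of each
    step. *)
Lemma compile_runs e : admissible e -> exists2 f, poly_bounded f &
  forall env X rho r s, (forall i, env i <= X) -> (forall i, rho i < r) ->
    (forall i, s (rho i) = bits_of_nat (env i)) ->
    (forall j, r <= j -> s j = [::]) ->
    runs (compile rho r e) s (f X) (update s r (bits_of_nat (eval_expr env e))).
Proof.
elim: e => [c|i|o e1 IH1 e2 IH2|o c i b IHb e IHe].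
- exists (fun=> size (bits_of_nat c) + 2); first exact: poly_bounded_const.
  by move=> env X rho r s _ _ _ s0; apply: runs_push_bits; apply: s0.
- exists (fun X => 9 * X + 2).
    exact: poly_bounded_add (poly_bounded_mul (poly_bounded_const 9)
      poly_bounded_id) (poly_bounded_const 2).
  move=> env X rho r s le rr sr s0 /=; have ri := rr i.
  apply: runs_eq (runs_le _ (runs_copy _ _ _ _ _)) _; rewrite ?sr ?s0//; try lia.
  have : size (bits_of_nat (env i)) <= X by apply/size_bits_of_nat/leq_ltn_trans/ltn_expl.
  by lia.
- move=> /= /andP[a1 a2].
  have [f pf fe] := IH1 a1; have [g pg ge] := IH2 a2.
  have [f' pf' fe'] := admissible_bound a1; have [g' pg' ge'] := admissible_bound a2.
  pose L X := f' X + g' X.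
  have pL : poly_bounded L := poly_bounded_add pf' pg'.
  exists (fun X => f X + (g X + (200 * (L X * L X) + 200))).
    apply: poly_bounded_add pf (poly_bounded_add pg (poly_bounded_add
      (poly_bounded_mul _ (poly_bounded_mul pL pL)) _)); exact: poly_bounded_const.
  move=> env X rho r s le rr sr s0.
  have R1 := fe _ _ _ _ _ le rr sr s0.
  set s1 := update _ _ _ in R1.
  have R2 : runs (compile rho r.+1 e2) s1 (g X)
      (update s1 r.+1 (bits_of_nat (eval_expr env e2))).
    apply: ge => // [j|j|j rj]; first by have := rr j; lia.
      by rewrite /s1 updateN ?sr//; have := rr j; lia.
    by rewrite /s1 updateN ?s0//; lia.
  apply: runs_eq (runs_seq R1 (runs_seq R2 (runs_binop (x := eval_expr env e1)
    (y := eval_expr env e2) (L := L X) o _ _ _ _ _ _ _ _))) _; try lia.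
  + by move=> j rj; rewrite /s1 2?updateN ?s0//; lia.
  + by rewrite updateN /s1 ?updateE//; lia.
  + by rewrite updateE.
  + by apply: leq_trans (fe' _ _ le) _; rewrite leq_exp2l// leq_addr.
  + by apply: leq_trans (ge' _ _ le) _; rewrite leq_exp2l// leq_addl.
  + by rewrite /s1; store_eq; rewrite s0.
- move=> /= /andP[lb ae].
  have [fb pfb fbe] := IHb (loop_free_admissible lb).
  have [fe pfe fee] := IHe ae.
  have [gb pgb gbe] := loop_free_bound lb.
  have [ge pge gee] := admissible_bound ae.
  pose X' X := X + gb X.
  have pX' : poly_bounded X' := poly_bounded_add poly_bounded_id pgb.
  (* every number met in the loop is below [2 ^ L X] *)
  pose L X := c + gb X * (ge (X' X) + 1) + ge (X' X) + gb X + 1.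
  have pge' : poly_bounded (fun X => ge (X' X)) by exact: poly_bounded_comp pge pX'.
  have p1 : poly_bounded (fun=> 1) := poly_bounded_const 1.
  have pL : poly_bounded L.
    do 4![apply: poly_bounded_add => //]; first exact: poly_bounded_const.
    exact: poly_bounded_mul pgb (poly_bounded_add pge' p1).
  pose T X := fe (X' X) + 3 * (200 * (L X * L X) + 200) + 2.
  have pT : poly_bounded T.
    apply: poly_bounded_add _ (poly_bounded_const 2).
    apply: poly_bounded_add; first exact: poly_bounded_comp pfe pX'.
    apply: poly_bounded_mul (poly_bounded_const 3) _.
    apply: poly_bounded_add _ (poly_bounded_const 200).
    exact: poly_bounded_mul (poly_bounded_const 200) (poly_bounded_mul pL pL).
  exists (fun X => size (bits_of_nat c) + 2 +
      (fb X + (gb X * (T X + 1) + 1 + (gb X * 2 + 1)))).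
    apply: poly_bounded_add (poly_bounded_const _) _.
    apply: (poly_bounded_add pfb).
    apply: poly_bounded_add; last first.
      exact: poly_bounded_add (poly_bounded_mul pgb (poly_bounded_const 2)) p1.
    exact: poly_bounded_add (poly_bounded_mul pgb (poly_bounded_add pT p1)) p1.
  move=> env X rho r s le rr sr s0.
  set N := eval_expr env b; have NX : N <= gb X := gbe _ _ le.
  pose v y := eval_expr (bind env i y) e.
  pose A k := iteri k (fun y a => binop_nat o a (v y)) c.
  have vE y : y < N -> v y < 2 ^ ge (X' X).
    by move=> yN; apply: gee => j; apply: bind_le => //; lia.
  have AL k : k <= N -> A k < 2 ^ L X.
    move=> kN; apply: leq_trans (iteri_binop_lt o c vE kN) _.
    rewrite leq_exp2l// /L; have : k <= gb X by lia.
    by nia.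
  have NL k : k <= N -> k < 2 ^ L X.
    move=> kN; apply: leq_trans (ltn_expl k (isT : 1 < 2)) _.
    by rewrite leq_exp2l// /L; lia.
  have oneL : 1 < 2 ^ L X by rewrite -[1]/(2 ^ 0) ltn_exp2l// /L addn1.
  pose S k := update (update (update s r (bits_of_nat (A k))) r.+1
     (bits_of_nat (N - k))) r.+2 (bits_of_nat k).
  have SE k : [/\ S k r = bits_of_nat (A k), S k r.+1 = bits_of_nat (N - k),
      S k r.+2 = bits_of_nat k, forall j, j < r -> S k j = s j &
      forall j, r.+2 < j -> S k j = [::]].
    split=> [||| j rj | j rj]; rewrite /S.
    - by rewrite 2?updateN ?updateE//; lia.
    - by rewrite 1?updateN ?updateE//; lia.
    - by rewrite updateE.
    - by rewrite 3?updateN//; lia.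
    - by rewrite 3?updateN ?s0//; lia.
  set body := Seq (compile (bind rho i r.+2) r.+3 e) _.
  have Rbody k : k < N -> runs body (S k) (T X) (S k.+1).
    move=> kN; have [Sr Sr1 Sr2 Slt Sgt] := SE k.
    have R1 : runs (compile (bind rho i r.+2) r.+3 e) (S k) (fe (X' X))
        (update (S k) r.+3 (bits_of_nat (v k))).
      apply: fee => [j|j|j|j rj].
      - by apply: bind_le => //; lia.
      - by rewrite /bind; case: eqP => _; [|have := rr j]; lia.
      - by rewrite /bind; case: eqP => _ //; rewrite Slt.
      - by rewrite Sgt//; lia.
    set s1 := update (S k) _ _ in R1.
    have R2 : runs (binop_prog o r r.+3 r.+4) s1 (200 * (L X * L X) + 200)
        (update (S k) r (bits_of_nat (A k.+1))).
      apply: runs_eq (runs_binop (x := A k) (y := v k) (L := L X) o _ _ _ _ _ _ _ _) _;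
        try lia.
      - by move=> j rj; rewrite /s1 updateN ?Sgt//; lia.
      - by rewrite /s1 updateN//; lia.
      - by rewrite /s1 updateE.
      - by apply: AL; lia.
      - apply: leq_trans (vE _ kN) _; rewrite leq_exp2l// /L; lia.
      - by rewrite /s1; store_eq; rewrite Sgt.
    set s2 := update (S k) _ _ in R2.
    have s2gt j : r.+2 < j -> s2 j = [::] by move=> rj; rewrite /s2 updateN ?Sgt//; lia.
    have R3 : runs (Push true r.+3) s2 1 (update s2 r.+3 (bits_of_nat 1)).
      by have := runs_push true r.+3 s2; rewrite s2gt// bits_of_nat1.
    set s3 := update s2 _ _ in R3.
    have R4 : runs (add_prog r.+2 r.+3 r.+4) s3 (200 * (L X * L X) + 200)
        (update s2 r.+2 (bits_of_nat k.+1)).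
      apply: runs_eq (runs_binop (x := k) (y := 1) (L := L X) OpAdd _ _ _ _ _ _ _ _) _;
        try lia.
      - by move=> j rj; rewrite /s3 updateN ?s2gt//; lia.
      - by rewrite /s3 /s2 2?updateN//; lia.
      - by rewrite /s3 updateE.
      - by apply: NL; lia.
      - by rewrite /s3 /= addn1; store_eq; rewrite s2gt.
    set s4 := update s2 _ _ in R4.
    have s4gt j : r.+2 < j -> s4 j = [::] by move=> rj; rewrite /s4 updateN ?s2gt//; lia.
    have R5 : runs (Push true r.+3) s4 1 (update s4 r.+3 (bits_of_nat 1)).
      by have := runs_push true r.+3 s4; rewrite s4gt// bits_of_nat1.
    set s5 := update s4 _ _ in R5.
    have R6 : runs (sub_prog r.+1 r.+3 r.+4) s5 (200 * (L X * L X) + 200) (S k.+1).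
      apply: runs_eq (runs_binop (x := N - k) (y := 1) (L := L X) OpSub _ _ _ _ _ _ _ _) _;
        try lia.
      - by move=> j rj; rewrite /s5 updateN ?s4gt//; lia.
      - by rewrite /s5 /s4 /s2 3?updateN//; lia.
      - by rewrite /s5 updateE.
      - by apply: NL; lia.
      - rewrite /= -subnDA addn1 /s5 /s4 /s2 {2}/S.
        move: Sgt; rewrite /S => Sgt; store_eq; rewrite s0//; lia.
    apply: runs_le (runs_seq R1 (runs_seq R2 (runs_seq R3 (runs_seq R4
      (runs_seq R5 R6))))).
    by rewrite /T; lia.
  have Rloop m k : N - k = m -> k <= N ->
      runs (While (Nonempty r.+1) body) (S k) (m * (T X + 1) + 1) (S N).
    elim: m k => [|m IH] k Nk kN.
      have -> : k = N by lia.
      have [_ S1 _ _ _] := SE N; apply: runs_while_false.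
      by rewrite /= S1 subnn bits_of_nat0.
    have [_ S1 _ _ _] := SE k.
    have h : holds (Nonempty r.+1) (S k) by rewrite /= S1 bits_of_nat_eq0 Nk.
    apply: runs_le (runs_while_true h (Rbody k _) (IH k.+1 _ _)); lia.
  have R1 := runs_push_bits (bits_of_nat c) (s0 r (leqnn r)).
  set s1 := update _ _ _ in R1.
  have R2 : runs (compile rho r.+1 b) s1 (fb X) (S 0).
    apply: runs_eq (fbe env X rho r.+1 s1 le _ _ _) _.
    - by move=> j; have := rr j; lia.
    - by move=> j; rewrite /s1 updateN ?sr//; have := rr j; lia.
    - by move=> j rj; rewrite /s1 updateN ?s0//; lia.
    - rewrite /S /s1 subn0 bits_of_nat0 -/N; store_eq; rewrite s0//; lia.
  have R3 := Rloop N 0 (subn0 N) isT.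
  have [_ _ S2 _ _] := SE N.
  apply: runs_eq (runs_le _ (runs_seq R1 (runs_seq R2 (runs_seq R3 (runs_clear _ _))))) _.
    have sN : size (bits_of_nat N) <= N by apply/size_bits_of_nat/ltn_expl.
    rewrite S2; have : N * (T X + 1) <= gb X * (T X + 1) by rewrite leq_mul.
    by lia.
  rewrite /S subnn bits_of_nat0; store_eq; rewrite s0//; lia.
Qed.

Lemma head_bits_of_nat n : head false (bits_of_nat n) = odd n.
Proof.
case: (posnP n) => [->|n0]; first by rewrite bits_of_nat0.
by rewrite -{1}[n]odd_double_half bits_of_nat_double// odd_double_half.
Qed.

(** The input is kept on the stack [0], as the value of every variable, until the
    three results on the stacks above it have been computed. *)
Lemma expr_program es en ed : admissible es -> admissible en -> admissible ed ->
  exists (p : prog) (c : nat), forall n, let env : nat -> nat := fun=> n in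
    0 < eval_expr env ed -> exists2 t, t <= (n + 2) ^ c &
      computes_in p n t ((-1) ^+ odd (eval_expr env es) * (eval_expr env en)%:R
                          / (eval_expr env ed)%:R)%R.
Proof.
move=> as_ an ad.
have [fs pfs Rs] := compile_runs as_; have [gs pgs Bs] := admissible_bound as_.
have [fn pfn Rn] := compile_runs an; have [gn pgn Bn] := admissible_bound an.
have [fd pfd Rd] := compile_runs ad; have [gd pgd Bd] := admissible_bound ad.
exists (Seq (compile (fun=> 0) 1 es) (Seq (compile (fun=> 0) 2 en)
  (Seq (compile (fun=> 0) 3 ed) (Seq (clear 0) (Seq (copy 1 0 4) (Seq (clear 1)
  (Seq (copy 2 1 4) (Seq (clear 2) (copy 3 2 4))))))))).
have [c cE] : poly_bounded (fun X => fs X + fn X + fd X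
    + 20 * (gs X + gn X + gd X + X) + 20).
  apply: (poly_bounded_add _ (poly_bounded_const 20)).
  apply: (poly_bounded_add _ (poly_bounded_mul (poly_bounded_const 20) _)).
    exact: (poly_bounded_add (poly_bounded_add pfs pfn) pfd).
  apply: (poly_bounded_add _ poly_bounded_id).
  exact: (poly_bounded_add (poly_bounded_add pgs pgn) pgd).
exists c => n env ed0.
have le : forall i : nat, env i <= n by [].
have {}Bs := size_bits_of_nat (Bs env n le).
have {}Bn := size_bits_of_nat (Bn env n le).
have {}Bd := size_bits_of_nat (Bd env n le).
have Bi : size (bits_of_nat n) <= n by apply/size_bits_of_nat/ltn_expl.
move: (eval_expr env es) (eval_expr env en) (eval_expr env ed) ed0 Bs Bn Bd
  (Rs env n (fun=> 0)) (Rn env n (fun=> 0)) (Rd env n (fun=> 0)).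
move=> vs vn vd vd0 Bs Bn Bd {}Rs {}Rn {}Rd.
set s0 := input n.
have R1 : runs (compile (fun=> 0) 1 es) s0 (fs n) (update s0 1 (bits_of_nat vs)).
  by apply: Rs => // -[|j].
have R2 : runs (compile (fun=> 0) 2 en) (update s0 1 (bits_of_nat vs)) (fn n)
    (update (update s0 1 (bits_of_nat vs)) 2 (bits_of_nat vn)).
  by apply: Rn => // -[|[|j]].
set s2 := update (update _ _ _) _ _ in R2.
have R3 : runs (compile (fun=> 0) 3 ed) s2 (fd n) (update s2 3 (bits_of_nat vd)).
  by apply: Rd => // -[|[|[|j]]].
set s3 := update s2 _ _ in R3.
have R4 := runs_clear 0 s3; set s4 := update s3 _ _ in R4.
have R5 : runs (copy 1 0 4) s4 (9 * size (s4 1)).+2 (update s4 0 (s4 1)).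
  by apply: runs_copy.
set s5 := update s4 _ _ in R5.
have R6 := runs_clear 1 s5; set s6 := update s5 _ _ in R6.
have R7 : runs (copy 2 1 4) s6 (9 * size (s6 2)).+2 (update s6 1 (s6 2)).
  by apply: runs_copy.
set s7 := update s6 _ _ in R7.
have R8 := runs_clear 2 s7; set s8 := update s7 _ _ in R8.
have R9 : runs (copy 3 2 4) s8 (9 * size (s8 3)).+2 (update s8 2 (s8 3)).
  by apply: runs_copy.
set s9 := update s8 _ _ in R9.
have [t tT ex] := runs_seq R1 (runs_seq R2 (runs_seq R3 (runs_seq R4 (runs_seq
  R5 (runs_seq R6 (runs_seq R7 (runs_seq R8 R9))))))).
exists t.
  apply: leq_trans tT (leq_trans _ (cE n)).
  rewrite -[s3 0]/(bits_of_nat n) -[s4 1]/(bits_of_nat vs).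
  rewrite -[s5 1]/(bits_of_nat vs) -[s6 2]/(bits_of_nat vn).
  rewrite -[s7 2]/(bits_of_nat vn) -[s8 3]/(bits_of_nat vd).
  by lia.
exists s9; split=> //.
  by rewrite -[s9 2]/(bits_of_nat vd) bits_of_natK -lt0n.
rewrite -[s9 0]/(bits_of_nat vs) -[s9 1]/(bits_of_nat vn) -[s9 2]/(bits_of_nat vd).
by rewrite head_bits_of_nat !bits_of_natK.
Qed.

(** * Functions computed by expressions *)

(** The variables from [r] on are free to serve as loop variables. *)
Definition level (T : Type) r (f : (nat -> nat) -> T) :=
  forall env env', (forall i, i < r -> env i = env' i) -> f env = f env'.

Lemma levelW T r (f : (nat -> nat) -> T) : level r f -> level r.+1 f.
Proof. by move=> fr env env' ee; apply: fr => i /ltnW; exact: ee. Qed.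

Lemma level_bind T r (f : (nat -> nat) -> T) env i y :
  level r f -> r <= i -> f (bind env i y) = f env.
Proof. by move=> fr ri; apply: fr => j jr; rewrite /bind; case: eqP; lia. Qed.

Definition computable (f : (nat -> nat) -> nat) :=
  exists2 e, admissible e & forall env, eval_expr env e = f env.

Definition computable_bound (f : (nat -> nat) -> nat) :=
  exists2 e, loop_free e & forall env, eval_expr env e = f env.

Definition nat_expr r f := level r f /\ computable f.

Definition bound_expr r f := level r f /\ computable_bound f.

Lemma bound_expr_nat r f : bound_expr r f -> nat_expr r f.
Proof. by move=> [fr [e /loop_free_admissible ae ee]]; split=> //; exists e. Qed.

Lemma nat_exprW r f : nat_expr r f -> nat_expr r.+1 f.
Proof. by move=> [/levelW]. Qed.

Lemma bound_exprW r f : bound_expr r f -> bound_expr r.+1 f.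
Proof. by move=> [/levelW]. Qed.

Lemma bound_expr_const r c : bound_expr r (fun=> c).
Proof. by split=> //; exists (Cst c). Qed.

Lemma bound_expr_var r i : i < r -> bound_expr r (fun env => env i).
Proof. by move=> ir; split; [move=> ? ?; exact|exists (Var i)]. Qed.

Lemma bound_expr_bin r o f g : bound_expr r f -> bound_expr r g ->
  bound_expr r (fun env => binop_nat o (f env) (g env)).
Proof.
move=> [fr [e1 ? e1f]] [gr [e2 ? e2g]]; split.
  by move=> env env' ee; rewrite (fr _ _ ee) (gr _ _ ee).
by exists (Bin o e1 e2) => [|env] /=; rewrite ?e1f ?e2g//; apply/andP.
Qed.

Lemma nat_expr_const r c : nat_expr r (fun=> c).
Proof. exact/bound_expr_nat/bound_expr_const. Qed.

Lemma nat_expr_bin r o f g : nat_expr r f -> nat_expr r g ->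
  nat_expr r (fun env => binop_nat o (f env) (g env)).
Proof.
move=> [fr [e1 ? e1f]] [gr [e2 ? e2g]]; split.
  by move=> env env' ee; rewrite (fr _ _ ee) (gr _ _ ee).
by exists (Bin o e1 e2) => [|env] /=; rewrite ?e1f ?e2g//; apply/andP.
Qed.

Lemma nat_expr_eq r f g : nat_expr r f -> nat_expr r g ->
  nat_expr r (fun env => f env == g env : nat).
Proof.
move=> fr gr.
have -> : (fun env => f env == g env : nat) =
    (fun env => 1 - ((f env - g env) + (g env - f env))).
  by apply/funext => env; case: eqP; lia.
apply: (nat_expr_bin OpSub (nat_expr_const r 1)).
by apply: (nat_expr_bin OpAdd); apply: (nat_expr_bin OpSub).
Qed.

Lemma level_agree_bind r (env env' : nat -> nat) y :
  (forall i, i < r -> env i = env' i) ->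
  forall i, i < r.+1 -> bind env r y i = bind env' r y i.
Proof. by move=> ee i ir; rewrite /bind; case: eqP => // ?; apply: ee; lia. Qed.

Lemma computable_big i o c b f : computable_bound b -> computable f ->
  computable (fun env =>
    iteri (b env) (fun y v => binop_nat o v (f (bind env i y))) c).
Proof.
move=> [eb lb ebE] [e ae eE]; exists (Big o c i eb e) => [|env] /=.
  by apply/andP.
by rewrite ebE; apply: eq_iteri => y v; rewrite eE.
Qed.

Lemma nat_expr_big r o c b f : bound_expr r b -> nat_expr r.+1 f ->
  nat_expr r (fun env =>
    iteri (b env) (fun y v => binop_nat o v (f (bind env r y))) c).
Proof.
move=> [br cb] [fr cf]; split; last exact: computable_big.
move=> env env' ee; rewrite (br _ _ ee); apply: eq_iteri => y v.
by congr (binop_nat o v _); exact/fr/level_agree_bind.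
Qed.

Lemma iteri_sum n (F : nat -> nat) :
  iteri n (fun y v => v + F y) 0 = \sum_(y < n) F y.
Proof. by elim: n => [|n IH]; rewrite ?big_ord0// big_ord_recr /= IH. Qed.

Lemma iteri_prod n (F : nat -> nat) :
  iteri n (fun y v => v * F y) 1 = \prod_(y < n) F y.
Proof. by elim: n => [|n IH]; rewrite ?big_ord0// big_ord_recr /= IH. Qed.

Lemma nat_expr_sum r b f : bound_expr r b -> nat_expr r.+1 f ->
  nat_expr r (fun env => \sum_(y < b env) f (bind env r y)).
Proof.
move=> br fr; have := nat_expr_big OpAdd 0 br fr; congr nat_expr.
by apply/funext => env; exact: iteri_sum.
Qed.

Lemma nat_expr_prod r b f : bound_expr r b -> nat_expr r.+1 f ->
  nat_expr r (fun env => \prod_(y < b env) f (bind env r y)).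
Proof.
move=> br fr; have := nat_expr_big OpMul 1 br fr; congr nat_expr.
by apply/funext => env; exact: iteri_prod.
Qed.

Lemma nat_expr_exp r b f : bound_expr r b -> nat_expr r f ->
  nat_expr r (fun env => f env ^ b env).
Proof.
move=> br fr; have := nat_expr_prod br (nat_exprW fr); congr nat_expr.
apply/funext => env; rewrite (eq_bigr (fun=> f env)).
  by rewrite prod_nat_const card_ord.
by move=> y _; apply: level_bind (leqnn r); case: fr.
Qed.

Lemma nat_expr_fact r b : bound_expr r b -> nat_expr r (fun env => (b env)`!).
Proof.
move=> br; have := nat_expr_prod br (nat_expr_bin OpAdd
  (bound_expr_nat (bound_expr_var (ltnSn r))) (nat_expr_const r.+1 1)).
congr nat_expr; apply/funext => env /=; rewrite fact_prod big_add1 big_mkord.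
by apply: eq_bigr => y _; rewrite /bind eqxx addn1.
Qed.

(** The number [b] is odd if and only if [b = 1 + 2 * y] for some [y < b]. *)
Lemma nat_expr_odd r b : bound_expr r b -> nat_expr r (fun env => odd (b env) : nat).
Proof.
move=> br.
have := nat_expr_sum br (nat_expr_eq (nat_expr_bin OpAdd (nat_expr_const r.+1 1)
  (nat_expr_bin OpMul (nat_expr_const r.+1 2)
  (bound_expr_nat (bound_expr_var (ltnSn r))))) (bound_expr_nat (bound_exprW br))).
congr nat_expr; apply/funext => env /=.
have bE y : b (bind env r y) = b env by apply: level_bind (leqnn r); case: br.
under eq_bigr do rewrite bE /bind eqxx.
move: (b env) => n; rewrite -[X in odd X]odd_double_half.
case: (odd n) (odd_double_half n) => /= E.
  have n2 : n./2 < n by lia.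
  rewrite oddD odd_double/= (bigD1 (Ordinal n2))//= big1 => [|i /eqP ni].
    by apply/eqP; lia.
  by apply/eqP; rewrite eqb0; apply/eqP => ?; apply: ni; apply/val_inj => /=; lia.
rewrite odd_double big1// => i _; apply/eqP; rewrite eqb0; apply/eqP; lia.
Qed.

Local Open Scope classical_set_scope.
Local Open Scope ring_scope.

(** Rationals are kept as fractions [(A - B) / C] of natural numbers, never
    reduced: only the numbers of digits matter, and they stay polynomial. *)
Definition rat_expr r (f : (nat -> nat) -> rat) :=
  exists A B C, [/\ nat_expr r A, nat_expr r B, nat_expr r C,
    forall env, (0 < C env)%N &
    forall env, f env = ((A env)%:R - (B env)%:R) / (C env)%:R].

Lemma rat_exprW r f : rat_expr r f -> rat_expr r.+1 f.
Proof.
by move=> [A [B [C [/nat_exprW ? /nat_exprW ? /nat_exprW ? ? ?]]]]; exists A, B, C.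
Qed.

Lemma rat_expr_level r f : rat_expr r f -> level r f.
Proof.
move=> [A [B [C [[Ar _] [Br _] [Cr _] _ E]]]] env env' ee.
by rewrite !E (Ar _ _ ee) (Br _ _ ee) (Cr _ _ ee).
Qed.

Lemma rat_expr_nat r f : nat_expr r f -> rat_expr r (fun env => (f env)%:R).
Proof.
move=> fr; exists f, (fun=> 0%N), (fun=> 1%N); split=> //.
- exact: nat_expr_const.
- exact: nat_expr_const.
- by move=> env; rewrite subr0 divr1.
Qed.

Lemma rat_expr_inv r f : nat_expr r f -> (forall env, (0 < f env)%N) ->
  rat_expr r (fun env => (f env)%:R^-1).
Proof.
move=> fr f0; exists (fun=> 1%N), (fun=> 0%N), f; split=> //.
- exact: nat_expr_const.
- exact: nat_expr_const.
- by move=> env; rewrite subr0 mul1r.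
Qed.

Lemma rat_expr_opp r f : rat_expr r f -> rat_expr r (fun env => - f env).
Proof.
move=> [A [B [C [Ar Br Cr C0 E]]]]; exists B, A, C; split=> // env.
by rewrite E -mulNr opprB.
Qed.

Lemma rat_expr_mul r f g :
  rat_expr r f -> rat_expr r g -> rat_expr r (fun env => f env * g env).
Proof.
move=> [A [B [C [Ar Br Cr C0 E]]]] [A' [B' [C' [Ar' Br' Cr' C0' E']]]].
exists (fun env => A env * A' env + B env * B' env)%N.
exists (fun env => A env * B' env + B env * A' env)%N.
exists (fun env => C env * C' env)%N; split.
- by apply: (nat_expr_bin OpAdd); apply: (nat_expr_bin OpMul).
- by apply: (nat_expr_bin OpAdd); apply: (nat_expr_bin OpMul).
- exact: (nat_expr_bin OpMul).
- by move=> env; rewrite muln_gt0 C0 C0'.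
move=> env; rewrite E E'; have := C0 env; have := C0' env.
rewrite !natrD !natrM -!(ltr0n rat) => /gt_eqF/negbT c0' /gt_eqF/negbT c0.
by field; rewrite c0 c0'.
Qed.

Lemma rat_expr_add r f g :
  rat_expr r f -> rat_expr r g -> rat_expr r (fun env => f env + g env).
Proof.
move=> [A [B [C [Ar Br Cr C0 E]]]] [A' [B' [C' [Ar' Br' Cr' C0' E']]]].
exists (fun env => A env * C' env + A' env * C env)%N.
exists (fun env => B env * C' env + B' env * C env)%N.
exists (fun env => C env * C' env)%N; split.
- by apply: (nat_expr_bin OpAdd); apply: (nat_expr_bin OpMul).
- by apply: (nat_expr_bin OpAdd); apply: (nat_expr_bin OpMul).
- exact: (nat_expr_bin OpMul).
- by move=> env; rewrite muln_gt0 C0 C0'.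
move=> env; rewrite E E'; have := C0 env; have := C0' env.
rewrite !natrD !natrM -!(ltr0n rat) => /gt_eqF/negbT c0' /gt_eqF/negbT c0.
by field; rewrite c0 c0'.
Qed.

Lemma rat_expr_sub r f g :
  rat_expr r f -> rat_expr r g -> rat_expr r (fun env => f env - g env).
Proof. by move=> fr /rat_expr_opp; exact: rat_expr_add. Qed.

Lemma rat_expr_const r q : rat_expr r (fun=> q).
Proof.
have N n : rat_expr r (fun=> n%:R) by exact/rat_expr_nat/nat_expr_const.
have d0 : (0 < `|denq q|)%N by rewrite absz_gt0 denq_neq0.
have D : rat_expr r (fun=> (`|denq q|%N)%:R^-1).
  by apply: rat_expr_inv => //; exact: nat_expr_const.
have -> : q = (numq q)%:~R / (`|denq q|%N)%:R.
  by rewrite -[LHS]divq_num_den pmulrn absz_denq.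
apply: rat_expr_mul D; case: (numq q) => n; first exact: N.
by rewrite NegzE mulrNz; apply: rat_expr_opp; exact: N.
Qed.

(** Even powers are products of natural numbers, whereas the sign of a power of
    [A - B] would have to be tracked. *)
Lemma rat_expr_sqr_exp r f b : rat_expr r f -> bound_expr r b ->
  rat_expr r (fun env => (f env ^+ 2) ^+ b env).
Proof.
move=> [A [B [C [Ar Br Cr C0 E]]]] br.
pose D env := ((A env - B env) + (B env - A env))%N.
have Dr : nat_expr r D by apply: (nat_expr_bin OpAdd); apply: (nat_expr_bin OpSub).
have DE env : ((A env)%:R - (B env)%:R) ^+ 2 = (D env)%:R ^+ 2 :> rat.
  rewrite /D; case: (leqP (A env) (B env)) => AB.
    have -> : (A env - B env = 0)%N by lia.
    by rewrite -sqrrN opprB -natrB// add0n.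
  have -> : (B env - A env = 0)%N by lia.
  by rewrite -natrB ?(ltnW AB)// addn0.
have Pr := nat_expr_exp br (nat_expr_bin OpMul Dr Dr).
have Qr := nat_expr_exp br (nat_expr_bin OpMul Cr Cr).
have Q0 env : (0 < (C env * C env) ^ b env)%N by rewrite expn_gt0 muln_gt0 C0.
have := rat_expr_mul (rat_expr_nat Pr) (rat_expr_inv Qr Q0).
congr rat_expr; apply/funext => env /=.
by rewrite E expr_div_n DE !natrX !natrM -!expr2 expr_div_n.
Qed.

Lemma rat_expr_sign r b : bound_expr r b -> rat_expr r (fun env => (-1) ^+ b env).
Proof.
move=> /nat_expr_odd/rat_expr_nat br.
have := rat_expr_sub (rat_expr_const r 1) (rat_expr_mul (rat_expr_const r 2) br).
congr rat_expr; apply/funext => env; rewrite -signr_odd.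
by case: (odd _) => /=; ring.
Qed.

(** Over the common denominator [\prod_z C z], the numerator of [A y / C y] is
    the product of all [C z] with [C y] replaced by [A y]. *)
Lemma rat_expr_sum r b f : bound_expr r b -> rat_expr r.+1 f ->
  rat_expr r (fun env => \sum_(y < b env) f (bind env r y)).
Proof.
move=> br [A [B [C [Ar Br Cr C0 E]]]].
pose num (N : (nat -> nat) -> nat) env := (\sum_(y < b env) \prod_(z < b env)
  (if z == y :> nat then N (bind env r z) else C (bind env r z)))%N.
have numr N : nat_expr r.+1 N -> nat_expr r (num N).
  move=> Nr; split.
    move=> env env' ee; rewrite /num (br.1 _ _ ee); apply: eq_bigr => y _.
    apply: eq_bigr => z _; have ee' := level_agree_bind z ee.
    by rewrite (Nr.1 _ _ ee') (Cr.1 _ _ ee').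
  pose F env := ((env r == env r.+1) * N env + (1 - (env r == env r.+1)) * C env)%N.
  have [_ Fc] : nat_expr r.+2 F.
    have e : nat_expr r.+2 (fun env => env r == env r.+1 : nat).
      by apply: nat_expr_eq; apply/bound_expr_nat/bound_expr_var; lia.
    apply: (nat_expr_bin OpAdd).
      exact: (nat_expr_bin OpMul e (nat_exprW Nr)).
    apply: (nat_expr_bin OpMul _ (nat_exprW Cr)).
    exact: (nat_expr_bin OpSub (nat_expr_const _ 1) e).
  have := computable_big r.+1 OpAdd 0 br.2 (computable_big r OpMul 1 br.2 Fc).
  congr computable; apply/funext => env; rewrite iteri_sum; apply: eq_bigr => y _.
  rewrite iteri_prod (level_bind _ _ br.1)//; apply: eq_bigr => z _.
  have drop G : nat_expr r.+1 G ->
      G (bind (bind env r.+1 y) r z) = G (bind env r z).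
    case=> Gr _; apply: Gr => i ir; rewrite /bind.
    by case: eqP => // _; case: eqP => // ?; lia.
  rewrite /F (drop _ Nr) (drop _ Cr) /bind eqxx (gtn_eqF (ltnSn r)) eqxx.
  by case: eqP; lia.
exists (num A), (num B), (fun env => \prod_(z < b env) C (bind env r z))%N.
split; [exact: numr|exact: numr|exact: nat_expr_prod|..].
  by move=> env; apply: prodn_gt0.
move=> env; rewrite /num !natr_sum -sumrB mulr_suml; apply: eq_bigr => y _.
rewrite E !(bigD1 (P := xpredT) y)//= eqxx.
rewrite (eq_bigr (fun z : 'I_(b env) => C (bind env r z))); last first.
  by move=> z /negbTE; rewrite -val_eqE /= => ->.
rewrite [X in (_ - (_ * X)%:R)](eq_bigr (fun z : 'I_(b env) => C (bind env r z))); last first.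
  by move=> z /negbTE; rewrite -val_eqE /= => ->.
set P := (\prod_(i < _ | _) _)%N.
have P0 : P%:R != 0 :> rat by rewrite pnatr_eq0 -lt0n prodn_gt0.
have c0 : (C (bind env r y))%:R != 0 :> rat by rewrite pnatr_eq0 -lt0n.
by rewrite !natrM; field; rewrite P0 c0.
Qed.

Lemma rat_expr_program f : rat_expr 1 f -> exists (p : prog) (c : nat),
  forall n, exists2 t, (t <= (n + 2) ^ c)%N & computes_in p n t (f (fun=> n)).
Proof.
move=> [A [B [C [Ar Br Cr C0 E]]]].
have Sr : nat_expr 1 (fun env => 1 - (A env + 1 - B env))%N.
  apply: (nat_expr_bin OpSub (nat_expr_const 1 1)).
  exact: (nat_expr_bin OpSub (nat_expr_bin OpAdd Ar (nat_expr_const 1 1)) Br).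
have Nr : nat_expr 1 (fun env => (A env - B env) + (B env - A env))%N.
  by apply: (nat_expr_bin OpAdd); apply: (nat_expr_bin OpSub).
have [_ [es as_ esE]] := Sr; have [_ [en an enE]] := Nr.
have [_ [ed ad edE]] := Cr.
have [p [c H]] := expr_program as_ an ad.
exists p, c => n; have := H n; rewrite /= edE => /(_ (C0 _)).
rewrite esE enE => -[t tn ct]; exists t => //.
congr computes_in: ct; rewrite E; congr (_ / _).
case: (ltnP (A (fun=> n)) (B (fun=> n))) => AB.
  rewrite (_ : (1 - _)%N = 1%N); last by lia.
  rewrite (_ : (A _ - _)%N = 0%N); last by lia.
  by rewrite add0n natrB 1?ltnW//= expr1 mulN1r opprB.
rewrite (_ : (1 - _)%N = 0%N); last by lia.
rewrite (_ : (B _ - _)%N = 0%N); last by lia.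
by rewrite addn0 natrB//= expr0 mul1r.
Qed.

(** * Exact quadrature of polynomials *)

Section alternating_sums.
Variable F : numFieldType.
Implicit Types f : nat -> F.

Let altsum n f := \sum_(m < n.+1) (-1) ^+ m * 'C(n, m)%:R * f m.

Let altsumS n f : altsum n.+1 f = altsum n f - altsum n (f \o S).
Proof.
rewrite /altsum big_ord_recl /= !bin0 -sumrN.
under eq_bigr do rewrite /bump /= binS natrD mulrDr mulrDl.
rewrite big_split /= addrA; congr (_ + _).
  rewrite [RHS]big_ord_recl bin0; congr (_ + _).
  by rewrite big_ord_recr /= bin_small// mulr0 mul0r addr0.
by apply: eq_bigr => i _; rewrite exprS mulN1r !mulNr.
Qed.

(** The [n]-th finite difference annihilates the powers below [n]. *)
Lemma altsum_expr n i : (i <= n)%N ->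
  \sum_(m < n.+1) (-1) ^+ m * 'C(n, m)%:R * m%:R ^+ i =
  (-1) ^+ n * n`!%:R * (i == n)%:R :> F.
Proof.
rewrite -/(altsum n (fun m => m%:R ^+ i)).
elim: n i => [|n IH] i ni.
  by move: ni; rewrite leqn0 => /eqP ->; rewrite /altsum big_ord1 !expr0 bin0 !mulr1.
rewrite altsumS; have -> : altsum n ((fun m => m%:R ^+ i) \o S) =
    altsum n (fun m => m%:R ^+ i) + \sum_(j < i) 'C(i, j)%:R * altsum n (fun m => m%:R ^+ j).
  rewrite /altsum; under [X in _ = _ + X]eq_bigr do rewrite mulr_sumr.
  rewrite exchange_big /= -big_split /=; apply: eq_bigr => m _.
  rewrite -natr1 [_ + 1]addrC exprDn big_ord_recr /= expr1n mul1r binn mulr1n.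
  rewrite mulrDr addrC; congr (_ + _); rewrite mulr_sumr; apply: eq_bigr => j _.
  by rewrite expr1n mul1r -(mulr_natl (m%:R ^+ j)) mulrCA.
rewrite opprD addrA subrr add0r.
rewrite (eq_bigr (fun j : 'I_i => 'C(i, j)%:R * ((-1) ^+ n * n`!%:R * (j == n :> nat)%:R))).
  move: ni; rewrite leq_eqVlt => /orP[/eqP ->|ni]; last first.
    rewrite big1 => [|j _]; first by rewrite oppr0 ltn_eqF ?mulr0.
    by rewrite ltn_eqF ?mulr0//; apply: leq_trans (ltn_ord j) _.
  rewrite big_ord_recr /= big1 => [|j _]; last by rewrite ltn_eqF ?mulr0.
  by rewrite !eqxx add0r binSn factS natrM exprS; ring.
by move=> j _; rewrite IH//; have := ltn_ord j; lia.
Qed.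

(** Faulhaber's formula with its leading coefficient, by induction from the
    telescoping sum of the differences of [j ^ (a + 1)]. *)
Lemma sum_of_powers a : exists c : nat -> F, c a = (a.+1)%:R^-1 /\
  forall n, \sum_(j < n) j%:R ^+ a = \sum_(i < a.+1) c i * n%:R ^+ i.+1.
Proof.
elim/ltn_ind: a => a IH.
have [C CE] : exists C : nat -> nat -> F, forall b, (b < a)%N -> forall n,
    \sum_(j < n) j%:R ^+ b = \sum_(i < a) C b i * n%:R ^+ i.+1.
  have /choice[C CE] : forall b, exists c : nat -> F, (b < a)%N -> forall n,
      \sum_(j < n) j%:R ^+ b = \sum_(i < a) c i * n%:R ^+ i.+1.
    move=> b; case: (ltnP b a) => ba; last by exists (fun=> 0).
    have [c [_ cE]] := IH b ba.
    exists (fun i => if (i <= b)%N then c i else 0) => _ n; rewrite cE.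
    rewrite (big_ord_widen a (fun i => c i * n%:R ^+ i.+1))// big_mkcond.
    by apply: eq_bigr => i _; rewrite ltnS; case: ifP => //; rewrite mul0r.
  by exists C.
exists (fun i => if i == a then a.+1%:R^-1 else
  - a.+1%:R^-1 * \sum_(b < a) 'C(a.+1, b)%:R * C b i); rewrite eqxx; split=> // n.
have a0 : a.+1%:R != 0 :> F by rewrite pnatr_eq0.
have tele : n%:R ^+ a.+1 = a.+1%:R * (\sum_(j < n) j%:R ^+ a) +
    \sum_(b < a) 'C(a.+1, b)%:R * \sum_(j < n) j%:R ^+ b :> F.
  rewrite mulr_sumr; under [X in _ + X]eq_bigr do rewrite mulr_sumr.
  rewrite exchange_big /= -big_split /=.
  elim: n => [|n IHn]; first by rewrite big_ord0 expr0n.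
  rewrite big_ord_recr /= -IHn -[in LHS]natr1 [in LHS]addrC exprDn.
  rewrite big_ord_recr /= expr1n mul1r binn mulr1n addrC; congr (_ + _).
  rewrite big_ord_recr /= expr1n mul1r binSn addrC mulr_natl; congr (_ + _).
  by apply: eq_bigr => b _; rewrite expr1n mul1r mulr_natl.
apply: (mulfI a0); rewrite (_ : a.+1%:R * _ = n%:R ^+ a.+1 -
    \sum_(b < a) 'C(a.+1, b)%:R * \sum_(j < n) j%:R ^+ b); last first.
  by rewrite tele addrK.
rewrite big_ord_recr /= eqxx mulrDr mulVKf// addrC; congr (_ + _).
rewrite mulr_sumr -sumrN.
under [RHS]eq_bigr => i _.
  rewrite ltn_eqF// !mulrA mulrN mulfV// mulN1r mulNr mulr_suml.
  over.
rewrite !sumrN exchange_big /=; congr (- _); apply: eq_bigr => b _.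
by rewrite CE// mulr_sumr; apply: eq_bigr => i _; rewrite mulrA.
Qed.

End alternating_sums.

(** The nodes are the fractions with denominators at most [D].  For a polynomial
    [h] of degree below [D], the product of [m ^ D] with the Riemann sum
    [m^-1 * \sum_(j < m) h (j / m)] is a polynomial in [m] whose coefficient of
    degree [D] is the integral of [h] over the unit interval, and the weights are
    those of the [D]-th finite difference divided by [D`!]. *)
Definition quad (F : numFieldType) D (h : F -> F) : F :=
  \sum_(m < D) ((-1) ^+ (D - m.+1) * ((m.+1)`!%:R^-1 * (D - m.+1)`!%:R^-1)) *
     m.+1%:R ^+ D.-1 * \sum_(j < m.+1) h (j%:R * m.+1%:R^-1).

Section quad.
Variable F : numFieldType.

Lemma quad_expr D a : (a < D)%N -> quad D (fun x : F => x ^+ a) = a.+1%:R^-1.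
Proof.
move=> aD; have [c [ca cE]] := sum_of_powers F a.
have D0 : D`!%:R != 0 :> F by rewrite pnatr_eq0 -lt0n fact_gt0.
pose T m := \sum_(i < a.+1) c i * m%:R ^+ (D - a + i).
have -> : quad D (fun x : F => x ^+ a) =
    (-1) ^+ D * D`!%:R^-1 * \sum_(m < D.+1) (-1) ^+ m * 'C(D, m)%:R * T m.
  rewrite big_ord_recl /= [T 0%N]big1 => [|i _]; last first.
    by rewrite expr0n; case: eqP => [|_]; [lia|rewrite mulr0].
  rewrite mulr0 add0r mulr_sumr; apply: eq_bigr => m _; rewrite /bump /= add1n.
  have mD : (m.+1 <= D)%N by [].
  have m0 : m.+1%:R != 0 :> F by rewrite pnatr_eq0.
  have -> : T m.+1 = m.+1%:R ^+ D.-1 * \sum_(j < m.+1) (j%:R * m.+1%:R^-1) ^+ a.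
    under eq_bigr do rewrite exprMn; rewrite -mulr_suml cE mulr_suml mulr_sumr.
    apply: eq_bigr => i _.
    have -> : m.+1%:R ^+ (D - a + i) = m.+1%:R ^+ D.-1 * m.+1%:R ^+ i.+1 * m.+1%:R^-1 ^+ a :> F.
      rewrite exprVn; apply: (canRL (mulfK (expf_neq0 a m0))).
      by rewrite -!exprD; congr (_ ^+ _); lia.
    by rewrite -mulrA mulrCA -[c i * _ * _]mulrA.
  rewrite !mulrA; congr (_ * _ * _); rewrite -!mulrA.
  have -> : (-1) ^+ (D - m.+1) = (-1) ^+ D * (-1) ^+ m.+1 :> F.
    by rewrite -exprD -signr_odd -[RHS]signr_odd oddB// oddD.
  rewrite -mulrA; congr (_ * _); rewrite [RHS]mulrCA; congr (_ * _).
  have b0 : 'C(D, m.+1)%:R != 0 :> F by rewrite pnatr_eq0 -lt0n bin_gt0.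
  by rewrite -(bin_fact mD) !natrM !invfM [_^-1 * (_ * _)]mulrC mulfVK.
rewrite /T; under eq_bigr do rewrite mulr_sumr; rewrite exchange_big /=.
rewrite big_ord_recr /= big1 => [|i _]; last first.
  have := ltn_ord i => /= ia.
  under eq_bigr do rewrite mulrCA; rewrite -mulr_sumr altsum_expr; last by lia.
  by rewrite ltn_eqF ?mulr0//; lia.
under eq_bigr do rewrite mulrCA; rewrite -mulr_sumr altsum_expr; last by lia.
rewrite subnK 1?ltnW// eqxx mulr1 add0r ca -signr_odd.
by move: (D`!%:R) D0 (a.+1%:R^-1) => d d0 x; case: odd => /=; field.
Qed.

Lemma quad_horner D (p P : {poly F}) : (size p <= D)%N -> P^`() = p ->
  quad D (horner p) = P.[1] - P.[0].
Proof.
move=> pD Pp.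
have -> : quad D (horner p) = \sum_(a < D) p`_a * quad D (fun x => x ^+ a).
  rewrite /quad; under [RHS]eq_bigr do rewrite mulr_sumr.
  rewrite exchange_big /=; apply: eq_bigr => m _.
  under eq_bigr do rewrite (horner_coef_wide _ pD).
  rewrite exchange_big /= mulr_sumr; apply: eq_bigr => a _.
  by rewrite -mulr_sumr mulrCA.
have PD : (size P <= D.+1)%N.
  apply/leq_sizeP => -[|j]; first by [].
  rewrite ltnS => Dj; have : p`_j = 0 by apply/(leq_sizeP _ _ pD).
  by rewrite -Pp coef_deriv => /eqP; rewrite mulrn_eq0 => /eqP.
rewrite !(horner_coef_wide _ PD) !big_ord_recl /= expr0 !mulr1.
rewrite [X in _ - (_ + X)]big1 => [|i _]; last by rewrite expr0n mulr0.
rewrite addr0 addrC addKr; apply: eq_bigr => a _.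
rewrite quad_expr// -Pp coef_deriv expr1n mulr1 -(mulr_natr P`_a.+1) mulfK//.
Qed.

Lemma quad_segment D (p P : {poly F}) l u : (size p <= D)%N -> P^`() = p ->
  (u - l) * quad D (fun s => p.[l + s * (u - l)]) = P.[u] - P.[l].
Proof.
move=> pD Pp; pose g : {poly F} := l%:P + (u - l) *: 'X.
have gE s : g.[s] = l + s * (u - l) by rewrite !hornerE mulrC.
have sg : (size g <= 2)%N.
  by rewrite (leq_trans (size_polyD _ _))// geq_max (leq_trans (size_polyC_leq1 _))//
    (leq_trans (size_scale_leq _ _))// size_polyX.
have := @quad_horner D ((u - l) *: (p \Po g)) (P \Po g).
rewrite deriv_comp Pp derivD derivC derivZ derivX add0r alg_polyC mulrC mul_polyC.
rewrite !horner_comp !gE mul0r addr0 mul1r [l + _]addrC subrK => <-//; last first.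
  apply: leq_trans (size_scale_leq _ _) _.
  case: (posnP (size p)) => [/eqP|p0].
    by rewrite size_poly_eq0 => /eqP ->; rewrite comp_poly0 size_poly0.
  apply: leq_trans (size_comp_poly_leq _ _) _.
  have : ((size p).-1 * (size g).-1 <= (size p).-1 * 1)%N by rewrite leq_mul//; lia.
  lia.
rewrite /quad mulr_sumr; apply: eq_bigr => m _; rewrite mulrCA; congr (_ * _).
rewrite mulr_sumr; apply: eq_bigr => j _.
by rewrite hornerZ horner_comp gE.
Qed.

End quad.

(** * Polynomial functions *)

Section polynomial_functions.
Variable R : realType.
Implicit Types (f g : seq R -> R) (t : seq R).

(** Polynomial functions of total degree at most the first argument.  Points are
    lists of coordinates, so that the first coordinate can be split off without
    changing types. *)
Inductive polyfun : nat -> (seq R -> R) -> Prop :=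
  | polyfun_const d c : polyfun d (fun=> c)
  | polyfun_coord d i : polyfun d.+1 (fun t => t`_i)
  | polyfun_add d f g : polyfun d f -> polyfun d g -> polyfun d (fun t => f t + g t)
  | polyfun_mul d e f g :
      polyfun d f -> polyfun e g -> polyfun (d + e) (fun t => f t * g t).

Lemma polyfunW d e f : (d <= e)%N -> polyfun d f -> polyfun e f.
Proof.
move=> de fd; elim: fd e de => {d f}.
- by move=> d c e _; exact: polyfun_const.
- by move=> d i [//|e] _; exact: polyfun_coord.
- by move=> d f g _ fd _ gd e de; apply: polyfun_add; [exact: fd|exact: gd].
- move=> d d' f g fd IHf gd IHg e de.
  by rewrite -(subnK de) addnA; apply: polyfun_mul => //; apply: IHf; rewrite leq_addl.
Qed.

Lemma polyfunZ d c f : polyfun d f -> polyfun d (fun t => c * f t).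
Proof. by move=> fd; rewrite -[d]add0n; apply: polyfun_mul => //; exact: polyfun_const. Qed.

Lemma polyfunB d f g : polyfun d f -> polyfun d g -> polyfun d (fun t => f t - g t).
Proof.
move=> fd /(polyfunZ (-1)) gd; have := polyfun_add fd gd.
by congr polyfun; apply/funext => t; rewrite mulN1r.
Qed.

Lemma polyfun_sum d n (F : nat -> seq R -> R) : (forall i, polyfun d (F i)) ->
  polyfun d (fun t => \sum_(i < n) F i t).
Proof.
move=> Fd; elim: n => [|n IH].
  have := polyfun_const d 0; congr polyfun; apply/funext => t.
  by rewrite big_ord0.
have := polyfun_add IH (Fd n); congr polyfun; apply/funext => t.
by rewrite big_ord_recr.
Qed.

Lemma polyfun_prod d n (F : nat -> seq R -> R) : (forall i, polyfun d (F i)) ->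
  polyfun (n * d) (fun t => \prod_(i < n) F i t).
Proof.
move=> Fd; elim: n => [|n IH].
  have := polyfun_const 0 1; congr polyfun; apply/funext => t.
  by rewrite big_ord0.
have := polyfun_mul IH (Fd n); rewrite mulSn addnC; congr polyfun.
by apply/funext => t; rewrite big_ord_recr.
Qed.

Lemma polyfun_cons d f g : polyfun d f -> polyfun 1 g ->
  polyfun d (fun t => f (g t :: t)).
Proof.
elim=> {d f}.
- by move=> d c _; exact: polyfun_const.
- move=> d [|i] gd /=; last exact: polyfun_coord.
  exact: polyfunW gd.
- by move=> d f h _ IHf _ IHh gd; apply: polyfun_add; [exact: IHf|exact: IHh].
- by move=> d e f h _ IHf _ IHh gd; apply: polyfun_mul; [exact: IHf|exact: IHh].
Qed.

Lemma polyfun_slice d f t : polyfun d f ->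
  exists2 p : {poly R}, (size p <= d.+1)%N & forall x, f (x :: t) = p.[x].
Proof.
elim=> {d f}.
- move=> d c; exists c%:P; last by move=> x; rewrite hornerC.
  exact: leq_trans (size_polyC_leq1 _) _.
- move=> d [|i] /=; first by exists 'X => [|x]; rewrite ?size_polyX ?hornerX.
  exists (t`_i)%:P; last by move=> x; rewrite hornerC.
  exact: leq_trans (size_polyC_leq1 _) _.
- move=> d f g _ [p pd pE] _ [q qd qE]; exists (p + q) => [|x].
    by rewrite (leq_trans (size_polyD _ _))// geq_max pd.
  by rewrite hornerD pE qE.
- move=> d e f g _ [p pd pE] _ [q qd qE]; exists (p * q) => [|x].
    by rewrite (leq_trans (size_polyMleq _ _))//; lia.
  by rewrite hornerM pE qE.
Qed.

Lemma polyfun_bounded d f (M : R) : polyfun d f ->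
  exists B, forall t, (forall i, `|t`_i| <= M) -> `|f t| <= B.
Proof.
elim=> {d f}.
- by move=> d c; exists `|c|.
- by move=> d i; exists M.
- move=> d f g _ [B fB] _ [C gC]; exists (B + C) => t tM.
  by apply: le_trans (ler_normD _ _) _; apply: lerD; [exact: fB|exact: gC].
- move=> d e f g _ [B fB] _ [C gC]; exists (B * C) => t tM.
  by rewrite normrM; apply: ler_pM => //; [exact: fB|exact: gC].
Qed.

Lemma polyfun_measurable k d f : polyfun d f ->
  measurable_fun setT (fun t : k.-tuple R => f t).
Proof.
elim=> {d f}.
- by move=> d c; exact: measurable_cst.
- move=> d i; case: (ltnP i k) => ik.
    have -> : (fun t : k.-tuple R => t`_i) = (fun t : k.-tuple R => tnth t (Ordinal ik)).
      by apply/funext => t; rewrite (tnth_nth 0).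
    exact: measurable_tnth.
  have -> : (fun t : k.-tuple R => t`_i) = cst 0.
    by apply/funext => t; rewrite nth_default// size_tuple.
  exact: measurable_cst.
- by move=> d f g _ mf _ mg; exact: measurable_funD.
- by move=> d e f g _ mf _ mg; exact: measurable_funM.
Qed.

End polynomial_functions.

(** * Affine forms and half-open polyhedra *)

(** The constant and the coefficients; missing coefficients are zero. *)
Definition affine := (rat * seq rat)%type.

Definition aff (F : numFieldType) (a : affine) (t : seq F) : F :=
  ratr a.1 + \sum_(i < size a.2) ratr a.2`_i * t`_i.

Definition aff_opp (a : affine) : affine := (- a.1, [seq - x | x <- a.2]).

Definition aff_sub (a b : affine) : affine :=
  (a.1 - b.1, mkseq (fun i => a.2`_i - b.2`_i) (maxn (size a.2) (size b.2))).

(** The root of the affine form as an equation for the first coordinate. *)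
Definition aff_root (a : affine) : affine :=
  (- a.1 / head 0 a.2, [seq - x / head 0 a.2 | x <- behead a.2]).

Definition aff_tail (a : affine) : affine := (a.1, behead a.2).

(** An inequality [0 < aff a t] (marked [true]) or [0 <= aff a t]. *)
Definition constr := (bool * affine)%type.

Definition sat (F : numFieldType) (c : constr) (t : seq F) : bool :=
  if c.1 then 0 < aff c.2 t else 0 <= aff c.2 t.

Definition region (F : numFieldType) (Q : seq constr) (t : seq F) : bool :=
  all (fun c => sat c t) Q.

Section affine.
Variable R : realType.
Implicit Types (t : seq R) (a b : affine).

Lemma aff_wide n a t : (size a.2 <= n)%N ->
  aff a t = ratr a.1 + \sum_(i < n) ratr a.2`_i * t`_i.
Proof.
move=> an; rewrite /aff (big_ord_widen n (fun i => ratr a.2`_i * t`_i))//.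
rewrite big_mkcond; congr (_ + _); apply: eq_bigr => i _.
by case: ltnP => // ai; rewrite nth_default// rmorph0 mul0r.
Qed.

Lemma aff_oppE a t : aff (aff_opp a) t = - aff a t.
Proof.
rewrite /aff /= size_map rmorphN opprD -sumrN; congr (_ + _).
by apply: eq_bigr => i _; rewrite (nth_map 0)// rmorphN mulNr.
Qed.

Lemma aff_subE a b t : aff (aff_sub a b) t = aff a t - aff b t.
Proof.
rewrite (aff_wide _ (leq_maxl (size a.2) (size b.2))).
rewrite (aff_wide _ (leq_maxr (size a.2) (size b.2))).
rewrite /aff /= size_mkseq rmorphB opprD addrACA -sumrB; congr (_ + _).
by apply: eq_bigr => i _; rewrite nth_mkseq// rmorphB mulrBl.
Qed.

Lemma aff_cons a x t : aff a (x :: t) = ratr (head 0 a.2) * x + aff (aff_tail a) t.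
Proof.
case: a => c [|h s]; rewrite /aff /=; first by rewrite !big_ord0 rmorph0 mul0r add0r.
by rewrite big_ord_recl /= addrCA.
Qed.

Lemma aff_rootE a t : head 0 a.2 != 0 ->
  aff (aff_root a) t = - aff (aff_tail a) t / ratr (head 0 a.2).
Proof.
move=> a0; rewrite /aff /= size_map rmorphM fmorphV rmorphN opprD mulrDl.
congr (_ + _); rewrite -sumrN mulr_suml; apply: eq_bigr => i _.
by rewrite (nth_map 0)// rmorphM fmorphV rmorphN -!mulNr mulrAC.
Qed.

Lemma aff_cons_root a x t : head 0 a.2 != 0 ->
  aff a (x :: t) = ratr (head 0 a.2) * (x - aff (aff_root a) t).
Proof.
move=> a0; rewrite aff_cons aff_rootE// mulrBr mulNr mulrN opprK.
by rewrite mulrCA mulfV ?mulr1// fmorph_eq0.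
Qed.

Lemma polyfun_aff a : polyfun 1 (fun t => aff a t).
Proof.
apply: polyfun_add; first exact: polyfun_const.
apply: (polyfun_sum _ (F := fun i t => ratr a.2`_i * t`_i)) => i.
by apply: polyfunZ; exact: polyfun_coord.
Qed.

(** ** Selecting the largest of finitely many affine forms *)

(** Pairs of a form of [L] and constraints that make it the first of the largest
    ones; because ties are broken in this way, exactly one case applies at every
    point. *)
Fixpoint max_cases (L : seq affine) : seq (affine * seq constr) :=
  if L is l :: L' then
    (l, [seq (false, aff_sub l l') | l' <- L']) ::
    [seq (m.1, (true, aff_sub m.1 l) :: m.2) | m <- max_cases L']
  else [::].

Definition min_cases (L : seq affine) : seq (affine * seq constr) :=
  [seq (aff_opp m.1, m.2) | m <- max_cases (map aff_opp L)].

(** The sum picks the value of [phi] at the maximum. *)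
Lemma max_casesP L t : L != [::] -> exists2 l, l \in L &
  (forall l', l' \in L -> aff l' t <= aff l t) /\
  forall (V : nmodType) (phi : R -> V),
    \sum_(m <- max_cases L) (if region m.2 t then phi (aff m.1 t) else 0)
    = phi (aff l t).
Proof.
elim: L => // l L IH _; case: (eqVneq L [::]) => [-> {IH}|/IH [m mL [mmax mE]]].
  exists l; first exact: mem_head.
  split=> [l'|V phi]; first by rewrite inE => /eqP ->.
  by rewrite /= big_cons big_nil addr0.
have lastE (V : nmodType) (phi : R -> V) :
    \sum_(m <- max_cases (l :: L)) (if region m.2 t then phi (aff m.1 t) else 0) =
    (if region [seq (false, aff_sub l l') | l' <- L] t then phi (aff l t) else 0) +
    (if aff l t < aff m t then phi (aff m t) else 0).
  rewrite /= big_cons big_map /=; congr (_ + _).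
  rewrite -(mE _ (fun x => if aff l t < x then phi x else 0)).
  apply: eq_bigr => m' _; rewrite /sat /= aff_subE subr_gt0.
  by case: (aff l t < _); case: (region _ _).
have regE : region [seq (false, aff_sub l l') | l' <- L] t = (aff m t <= aff l t).
  rewrite /region all_map; apply/allP/idP => [/(_ m mL)|ml l' l'L];
    rewrite /sat /= aff_subE subr_ge0 // => *.
  exact: le_trans (mmax _ l'L) ml.
case: (leP (aff m t) (aff l t)) => ml.
  exists l; first exact: mem_head.
  split=> [l'|V phi]; last by rewrite lastE regE ml ltNge ml addr0.
  by rewrite inE => /predU1P[->//|l'L]; apply: le_trans (mmax _ l'L) ml.
exists m; first by rewrite inE mL orbT.
split=> [l'|V phi]; last by rewrite lastE regE leNgt ml add0r.
by rewrite inE => /predU1P[->|/mmax//]; exact: ltW.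
Qed.

Lemma min_casesP L t : L != [::] -> exists2 l, l \in L &
  (forall l', l' \in L -> aff l t <= aff l' t) /\
  forall (V : nmodType) (phi : R -> V),
    \sum_(m <- min_cases L) (if region m.2 t then phi (aff m.1 t) else 0)
    = phi (aff l t).
Proof.
move=> L0; have L0' : map aff_opp L != [::] by case: (L) L0.
have [k /mapP[l lL kE]] := max_casesP t L0'; rewrite {k}kE => -[lmax lE].
exists l => //; split=> [l' l'L|V phi].
  by have := lmax _ (map_f aff_opp l'L); rewrite !aff_oppE lerN2.
rewrite big_map /= -[aff l t]opprK -aff_oppE -(lE _ (fun x => phi (- x))).
by apply: eq_bigr => m _; rewrite aff_oppE.
Qed.

(** ** Eliminating the first coordinate *)

Definition lower_bounds (Q : seq constr) :=
  [seq aff_root c.2 | c <- Q & 0 < head 0 c.2.2].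

Definition upper_bounds (Q : seq constr) :=
  [seq aff_root c.2 | c <- Q & head 0 c.2.2 < 0].

Definition side_constraints (Q : seq constr) :=
  [seq (c.1, aff_tail c.2) | c <- Q & head 0 c.2.2 == 0].

(** The fiber over [t] is an interval; this lemma and the next one locate it up to
    its end points, whose membership depends on the strictness of the
    constraints. *)
Lemma region_cons_le Q x t : region Q (x :: t) ->
  [/\ region (side_constraints Q) t,
      forall l, l \in lower_bounds Q -> aff l t <= x &
      forall u, u \in upper_bounds Q -> x <= aff u t].
Proof.
move=> /allP QP; split.
- rewrite /region /side_constraints all_map; apply/allP => c.
  rewrite mem_filter => /andP[/eqP c0 /QP].
  by rewrite /sat aff_cons c0 rmorph0 mul0r add0r.
- move=> l /mapP[c + ->{l}]; rewrite mem_filter => /andP[c0 /QP].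
  have r0 : (0 : R) < ratr (head 0 c.2.2) by rewrite ltr0q.
  rewrite /sat (aff_cons_root _ _ (lt0r_neq0 c0)) pmulr_rgt0// pmulr_rge0//.
  by rewrite subr_gt0 subr_ge0; case: ifP => // _; exact: ltW.
- move=> l /mapP[c + ->{l}]; rewrite mem_filter => /andP[c0 /QP].
  have r0 : ratr (head 0 c.2.2) < (0 : R) by rewrite ltrq0.
  rewrite /sat (aff_cons_root _ _ (ltr0_neq0 c0)) nmulr_rgt0// nmulr_rge0//.
  by rewrite subr_lt0 subr_le0; case: ifP => // _; exact: ltW.
Qed.

Lemma region_cons_lt Q x t : region (side_constraints Q) t ->
  (forall l, l \in lower_bounds Q -> aff l t < x) ->
  (forall u, u \in upper_bounds Q -> x < aff u t) -> region Q (x :: t).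
Proof.
move=> /allP SP LP UP; apply/allP => c cQ; rewrite /sat.
case: (ltgtP 0 (head 0 c.2.2)) => c0.
- have r0 : (0 : R) < ratr (head 0 c.2.2) by rewrite ltr0q.
  have /LP xl : aff_root c.2 \in lower_bounds Q.
    by apply/mapP; exists c => //; rewrite mem_filter c0.
  rewrite (aff_cons_root _ _ (lt0r_neq0 c0)) pmulr_rgt0// pmulr_rge0//.
  by rewrite subr_gt0 subr_ge0; case: ifP => // _; exact: ltW.
- have r0 : ratr (head 0 c.2.2) < (0 : R) by rewrite ltrq0.
  have /UP xu : aff_root c.2 \in upper_bounds Q.
    by apply/mapP; exists c => //; rewrite mem_filter c0.
  rewrite (aff_cons_root _ _ (ltr0_neq0 c0)) nmulr_rgt0// nmulr_rge0//.
  by rewrite subr_lt0 subr_le0; case: ifP => // _; exact: ltW.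
- have : (c.1, aff_tail c.2) \in side_constraints Q.
    by apply/mapP; exists c => //; rewrite mem_filter -c0 eqxx.
  by move=> /SP; rewrite /sat /= aff_cons -c0 rmorph0 mul0r add0r.
Qed.

(** The points whose fiber is an interval from [l.1] to [u.1] of positive length. *)
Definition fiber_region Q (l u : affine * seq constr) : seq constr :=
  (true, aff_sub u.1 l.1) :: side_constraints Q ++ l.2 ++ u.2.

End affine.

(** * Integration over a fiber *)

Section fiber_integral.
Variable R : realType.
Notation lambda := (@lebesgue_measure R).

(** The end points form a null set, so the integral is the same whichever of them
    belong to [s]. *)
Lemma integral_poly_interval (s : measurableTypeR R -> bool) (p P : {poly R}) (a b : R) :
  measurable_fun setT s -> P^`() = p ->
  (forall x, s x -> a <= x <= b) -> (forall x, a < x < b -> s x) ->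
  (\int[lambda]_x (if s x then p.[x] else 0)%:E =
   (if a < b then P.[b] - P.[a] else 0)%:E)%E.
Proof.
move=> ms Pp sle slt.
have mp : measurable_fun setT (horner p).
  by apply: continuous_measurable_fun; exact: continuous_horner.
pose i x := (a < b) && (x \in `[a, b]).
have mi : measurable_fun setT (i : measurableTypeR R -> bool).
  apply: (measurable_fun_bool true); rewrite setTI /i.
  case: ltP => ab /=; last first.
    rewrite (_ : (fun x => _) @^-1` _ = set0); first exact: measurable0.
    by apply/seteqP; split.
  have := @measurable_itv R `[a, b].
  by congr measurable; apply/seteqP; split=> x h; exact: h.
transitivity (\int[lambda]_x (if i x then p.[x] else 0)%:E)%E.
  apply: ae_eq_integral => //.
  - apply/measurable_EFinP; exact: measurable_fun_ifT.
  - apply/measurable_EFinP; exact: measurable_fun_ifT.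
  exists ([set a; b] : set (measurableTypeR R)); split.
  - by apply: measurableU; exact: measurable_set1.
  - apply: countable_lebesgue_measure0; apply: finite_set_countable; exact: finite_set2.
  move=> x /= /not_implyP[_ neq]; apply: contra_notP neq => /not_orP[/eqP xa /eqP xb].
  suff -> : s x = i x by [].
  apply/idP/idP => [/[dup] /sle /andP[ax xb'] _|].
    rewrite /i in_itv /= ax xb' andbT.
    by rewrite (@lt_le_trans _ _ x)// lt_neqAle ax eq_sym xa.
  rewrite /i in_itv /= => /and3P[ab ax xb']; apply: slt.
  by rewrite !lt_neqAle ax xb' xb eq_sym xa.
rewrite /i; case: ltP => ab /=; last by rewrite integral0.
transitivity (\int[lambda]_(x in `[a, b]) (p.[x])%:E)%E.
  rewrite [RHS]integral_mkcond; apply: eq_integral => x _.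
  by rewrite patchE mem_setE; case: ifP.
rewrite (@continuous_FTC2 _ _ (horner P))//.
- by apply: continuous_subspaceT => x; exact: continuous_horner.
- split=> [x _||]; first exact: derivable_horner.
  + by apply: cvg_at_right_filter; exact: continuous_horner.
  + by apply: cvg_at_left_filter; exact: continuous_horner.
- by move=> x _; rewrite -derivE Pp.
Qed.

Lemma poly_antiderivative (p : {poly R}) : exists P : {poly R}, P^`() = p.
Proof.
exists (\poly_(i < (size p).+1) (p`_i.-1 / i%:R)); apply/polyP => i.
rewrite coef_deriv coef_poly ltnS; case: ltnP => ip /=.
  by rewrite -(mulr_natr (_ / _)) mulfVK// pnatr_eq0.
by rewrite mul0rn nth_default.
Qed.

Lemma region_measurable k (Q : seq constr) :
  measurable_fun setT (fun t : k.-tuple R => region Q t).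
Proof.
elim: Q => [|c Q IH] /=; first exact: measurable_cst.
apply: measurable_and => //; rewrite /sat.
have mc := @polyfun_measurable R k _ _ (polyfun_aff R c.2).
by case: c.1; [apply: measurable_fun_ltr|apply: measurable_fun_ler].
Qed.

Lemma measurable_cons_tuple k (t : k.-tuple R) :
  measurable_fun setT (fun x : measurableTypeR R => [tuple of x :: t]).
Proof.
apply: (measurableT_comp (measurable_cons_pair (R := R) (k := k))
  (g := fun x => (x, t))).
exact: measurable_pair2.
Qed.

(** For polynomials [f] of degree below [D], this is the integral of [f (x :: t)]
    over [x] from [aff l t] to [aff u t]. *)
Definition quad_fiber (F : numFieldType) (l u : affine) (f : seq F -> F) D t :=
  (aff u t - aff l t) *
  quad D (fun s => f (aff l t + s * (aff u t - aff l t) :: t)).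

Definition fiber_cases Q : seq ((affine * seq constr) * (affine * seq constr)) :=
  [seq (l, u) | l <- max_cases (lower_bounds Q), u <- min_cases (upper_bounds Q)].

Lemma fiber_integral k Q d (f : seq R -> R) D (t : k.-tuple R) :
  polyfun d f -> (d < D)%N -> lower_bounds Q != [::] -> upper_bounds Q != [::] ->
  (\int[lambda]_x (if region Q (x :: t) then f (x :: t) else 0)%:E =
   (\sum_(c <- fiber_cases Q)
     (if region (fiber_region Q c.1 c.2) t then quad_fiber c.1.1 c.2.1 f D t
      else 0))%:E)%E.
Proof.
move=> fd dD L0 U0.
have [p pd pE] := polyfun_slice t fd; have [P Pp] := poly_antiderivative p.
have [l lL [lmax lE]] := max_casesP t L0.
have [u uU [umin uE]] := min_casesP t U0.
pose phi x y := if x < y then P.[y] - P.[x] else 0.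
have caseE c : (if region (fiber_region Q c.1 c.2) t then
      quad_fiber c.1.1 c.2.1 f D t else 0) =
    if region (side_constraints Q) t then
      if region c.1.2 t then
        if region c.2.2 t then phi (aff c.1.1 t) (aff c.2.1 t) else 0
      else 0 else 0.
  rewrite /region /= !all_cat /sat /= aff_subE subr_gt0 /phi.
  have -> : quad_fiber c.1.1 c.2.1 f D t = P.[aff c.2.1 t] - P.[aff c.1.1 t].
    rewrite -(quad_segment _ _ (leq_trans pd dD) Pp) /quad_fiber; congr (_ * _).
    by apply: eq_bigr => i _; congr (_ * _); apply: eq_bigr => j _; exact: pE.
  by do 3 case: all; case: ltP.
under [in RHS]eq_bigr do rewrite caseE.
case: (boolP (region (side_constraints Q) t)) => side; last first.
  rewrite big1// integral0_eq// => x _.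
  by case: ifP => // /region_cons_le[]; rewrite (negbTE side).
rewrite big_allpairs /=.
under [in RHS]eq_bigr => c _.
  rewrite (_ : \sum_(_ <- _) _ =
      (if region c.2 t then phi (aff c.1 t) (aff u t) else 0)); last first.
    by case: (region c.2 t); [exact: (uE _ (phi (aff c.1 t)))|exact: big1].
  over.
rewrite (lE _ (fun x => phi x (aff u t))) /phi.
rewrite -(@integral_poly_interval (fun x => region Q (x :: t)) p)//.
- by apply: eq_integral => x _; rewrite pE.
- exact: (measurableT_comp (@region_measurable k.+1 Q) (measurable_cons_tuple t)).
- move=> x /region_cons_le[_ xL xU].
  by rewrite (xL _ lL) (xU _ uU).
move=> x /andP[lx xu]; apply: region_cons_lt => // [l' l'L|u' u'U].
  exact: le_lt_trans (lmax _ l'L) lx.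
exact: lt_le_trans xu (umin _ u'U).
Qed.

End fiber_integral.

(** * Integration over polyhedra *)

Section integral_tuple.
Variable R : realType.
Notation lambda := (@lebesgue_measure R).

Lemma integrable_bounded_support k (g : k.-tuple R -> R) (M B : R) :
  measurable_fun setT g -> (forall t, `|g t| <= B) ->
  (forall t, g t != 0 -> forall i, `|tnth t i| <= M) ->
  (lebesgue_tuple R k).-integrable setT (EFin \o g).
Proof.
move=> mg gB gM.
pose A : set (k.-tuple R) := [set t | forall i, `[- M, M]%classic (tnth t i)].
have mA : measurable A.
  rewrite (_ : A = \bigcap_(i in [set: 'I_k]) ((@tnth k R)^~ i @^-1` `[- M, M])).
    apply: fin_bigcap_measurable => // i _.
    by rewrite -[X in measurable X]setTI; exact: measurable_tnth.
  by apply/seteqP; split=> t At i; [move=> _|]; exact: At.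
have Afin : (lebesgue_tuple R k A < +oo)%E.
  rewrite (@lebesgue_tuple_box R k (fun=> `[- M, M]%classic)) => [|i]; last first.
    exact: measurable_itv.
  set v := lebesgue_measure _; have /fineK <- : v \is a fin_num.
    by rewrite /v lebesgue_measure_itv /=; case: ifP => _ //; rewrite -EFinB.
  by rewrite prodEFin ltry.
have intA : (lebesgue_tuple R k).-integrable A (EFin \o g).
  apply: measurable_bounded_integrable => //; first exact: measurable_funTS.
  by exists B; rewrite num_real; split=> // x Bx t _ /=; apply: le_trans (gB t) (ltW Bx).
move/(integrable_mkcond _ mA): intA; congr integrable.
apply/funext => t; rewrite patchE; case: ifPn => //= tA.
apply/esym/eqP; case: (eqVneq (g t) 0) => [->//|/gM gt]; case/negP: tA.
by rewrite inE => i; rewrite /= in_itv /= -ler_norml.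
Qed.

(** Fubini's theorem, the first coordinate being integrated first. *)
Lemma integral_tuple_cons k (G : k.+1.-tuple R -> \bar R) :
  (lebesgue_tuple R k.+1).-integrable setT G ->
  (\int[lebesgue_tuple R k.+1]_t G t =
   \int[lebesgue_tuple R k]_t \int[lambda]_x G [tuple of x :: t])%E.
Proof.
move=> /integrableP[mG intG].
have mc := @measurable_cons_pair R k.
have mGc : measurable_fun setT (G \o @cons_pair R k) by exact: measurableT_comp.
have intGc : (lambda \x lebesgue_tuple R k)%E.-integrable setT (G \o @cons_pair R k).
  apply/integrableP; split=> //; move: intG => /=.
  rewrite (ge0_integral_pushforward mc)//; first exact: measurableT_comp.
transitivity (\int[(lambda \x lebesgue_tuple R k)%E]_z (G \o @cons_pair R k) z)%E.
  exact: (integral_pushforward mc).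
by rewrite -integral21_prod_meas1.
Qed.

End integral_tuple.

(** A chamber lists, for each coordinate in turn, the affine forms of the later
    coordinates between which it varies. *)
Definition chamber := seq (affine * affine).

Fixpoint cubature (F : numFieldType) (c : chamber) (f : seq F -> F) D : F :=
  if c is (l, u) :: c' then cubature c' (quad_fiber l u f D) D else f [::].

Section cubature.
Variable R : realType.
Notation lambda := (@lebesgue_measure R).

Lemma polyfun_quad_fiber d (f : seq R -> R) l u D : polyfun d f ->
  polyfun d.+1 (quad_fiber l u f D).
Proof.
move=> fd; have lin := polyfunB (polyfun_aff R u) (polyfun_aff R l).
apply: (polyfun_mul lin); rewrite /quad.
pose w m : R := (-1) ^+ (D - m.+1) * (m.+1`!%:R^-1 * (D - m.+1)`!%:R^-1) * m.+1%:R ^+ D.-1.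
apply: (polyfun_sum _ (F := fun m t => w m * \sum_(j < m.+1)
   f (aff l t + j%:R * m.+1%:R^-1 * (aff u t - aff l t) :: t))) => m.
apply: polyfunZ; apply: (polyfun_sum _ (F := fun j t =>
   f (aff l t + j%:R * m.+1%:R^-1 * (aff u t - aff l t) :: t))) => j.
by apply: polyfun_cons fd _; apply: polyfun_add (polyfun_aff R l) (polyfunZ _ lin).
Qed.

Lemma max_cases_le L m (t : seq R) : m \in max_cases L -> region m.2 t ->
  forall l, l \in L -> aff l t <= aff m.1 t.
Proof.
elim: L m => // l L IH m /=; rewrite inE => /predU1P[->|/mapP[m' m'L ->]] /=.
  rewrite /region all_map => /allP reg l'; rewrite inE => /predU1P[->//|/reg].
  by rewrite /sat /= aff_subE subr_ge0.
rewrite /sat /= aff_subE subr_gt0 => /andP[lm' reg] l'.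
by rewrite inE => /predU1P[->|/(IH _ m'L reg)//]; exact: ltW.
Qed.

Lemma min_cases_le L m (t : seq R) : m \in min_cases L -> region m.2 t ->
  forall l, l \in L -> aff m.1 t <= aff l t.
Proof.
move=> /mapP[m' m'L ->] /= reg l lL.
by have := max_cases_le m'L reg (map_f aff_opp lL); rewrite !aff_oppE lerNl.
Qed.

Definition bounded_region k (Q : seq constr) (M : R) :=
  forall t : seq R, size t = k -> region Q t -> forall i, `|t`_i| <= M.

(** The middle of a fiber of positive length lies in the polyhedron, so the
    projection inherits its bound. *)
Lemma bounded_fiber_region k Q M c : bounded_region k.+1 Q M ->
  c \in fiber_cases Q -> bounded_region k (fiber_region Q c.1 c.2) M.
Proof.
move=> QM /allpairsP[[l u] /= [lL uU ->]] t tk /=.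
rewrite /region /= !all_cat /sat /= aff_subE subr_gt0 => /and4P[lu side lreg ureg] i.
pose x := (aff l.1 t + aff u.1 t) / 2.
have lx : aff l.1 t < x by rewrite /x; lra.
have xu : x < aff u.1 t by rewrite /x; lra.
apply: (QM (x :: t) _ _ i.+1); first by rewrite /= tk.
apply: region_cons_lt => // [l' l'L|u' u'U].
  exact: le_lt_trans (max_cases_le lL lreg l'L) lx.
exact: lt_le_trans xu (min_cases_le uU ureg u'U).
Qed.

Lemma region_move Q x y (t : seq R) :
  (forall c, c \in Q -> 0 <= ratr (head 0 c.2.2) * (y - x)) ->
  region Q (x :: t) -> region Q (y :: t).
Proof.
move=> Qxy /allP xt; apply/allP => c cQ; have := xt c cQ; have := Qxy c cQ.
rewrite mulrBr subr_ge0 => le; rewrite /sat !aff_cons.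
by case: ifP => _ h; [apply: lt_le_trans h _|apply: le_trans h _]; rewrite lerD2r.
Qed.

(** Without a lower bound the first coordinate could decrease forever. *)
Lemma lower_bounds_neq0 k Q M x (t : seq R) : bounded_region k.+1 Q M ->
  size t = k -> region Q (x :: t) -> lower_bounds Q != [::].
Proof.
move=> QM tk xt; apply/eqP => L0.
have /QM : region Q (x - (`|x| + `|M| + 1) :: t).
  apply: region_move xt => c cQ.
  have c0 : head 0 c.2.2 <= 0.
    rewrite leNgt; apply/negP => c0.
    suff : aff_root c.2 \in [::] by [].
    by rewrite -L0; apply/mapP; exists c => //; rewrite mem_filter c0.
  by rewrite mulr_le0// ?lerq0//; have := normr_ge0 x; have := normr_ge0 M; lra.
rewrite /= tk => /(_ erefl 0%N) /=; rewrite ler_norml => /andP[+ _].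
by have := ler_norm x; have := ler_norm M; lra.
Qed.

Lemma upper_bounds_neq0 k Q M x (t : seq R) : bounded_region k.+1 Q M ->
  size t = k -> region Q (x :: t) -> upper_bounds Q != [::].
Proof.
move=> QM tk xt; apply/eqP => U0.
have /QM : region Q (x + (`|x| + `|M| + 1) :: t).
  apply: region_move xt => c cQ.
  have c0 : 0 <= head 0 c.2.2.
    rewrite leNgt; apply/negP => c0.
    suff : aff_root c.2 \in [::] by [].
    by rewrite -U0; apply/mapP; exists c => //; rewrite mem_filter c0.
  by rewrite mulr_ge0// ?ler0q//; have := normr_ge0 x; have := normr_ge0 M; lra.
rewrite /= tk => /(_ erefl 0%N) /=; rewrite ler_norml => /andP[_].
have := ler_norm (- x); rewrite normrN.
by have := ler_norm M; lra.
Qed.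

Lemma region_integrable k Q M d (f : seq R -> R) : bounded_region k Q M ->
  polyfun d f -> (lebesgue_tuple R k).-integrable setT
    (fun t => (if region Q t then f t else 0)%:E).
Proof.
move=> QM fd; have [B fB] := polyfun_bounded M fd.
apply: (@integrable_bounded_support _ _ _ M `|B|).
- apply: measurable_fun_ifT; first exact: region_measurable.
    exact: polyfun_measurable fd.
  exact: measurable_cst.
- move=> t; case: ifP => Qt; last by rewrite normr0.
  apply: le_trans (ler_norm _); apply: fB; apply: QM => //.
  exact: size_tuple.
move=> t; case: ifP => [Qt _ i|]; last by rewrite eqxx.
by rewrite (tnth_nth 0); apply: QM => //; exact: size_tuple.
Qed.

(** Fourier-Motzkin elimination: the fibers over the projection of a polyhedron
    along the first coordinate are intervals whose end points are piecewise
    affine.  Over each piece, the integral over the fiber is again a polynomial,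
    namely an instance of the quadrature formula. *)
Theorem integral_polyhedron k Q M : bounded_region k Q M -> exists cs : seq chamber,
  forall d (f : seq R -> R) D, polyfun d f -> (d + k <= D)%N ->
  (\int[lebesgue_tuple R k]_t (if region Q t then f t else 0)%:E =
   (\sum_(c <- cs) cubature c f D)%:E)%E.
Proof.
elim: k Q => [|k IH] Q QM.
  exists (if region Q ([::] : seq R) then [:: [::]] else [::]) => d f D fd _.
  have intE := integrableP _ _ _ (region_integrable QM fd).
  rewrite /= integral_dirac//=; last by case: intE.
  rewrite diracE mem_set// mul1e.
  by case: ifP => _; rewrite ?big_cons big_nil ?addr0.
have [|empty] := pselect (exists t : k.+1.-tuple R, region Q t); last first.
  exists [::] => d f D fd _; rewrite big_nil integral0_eq// => t _.
  by case: ifP => // Qt; case: empty; exists t.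
move=> [t0]; rewrite [t0]tuple_eta /= => Qt0.
have sz : size (behead t0) = k by rewrite size_behead size_tuple.
have L0 := lower_bounds_neq0 QM sz Qt0.
have U0 := upper_bounds_neq0 QM sz Qt0.
have /choice[cs csP] : forall c, exists cs : seq chamber, c \in fiber_cases Q ->
    forall d (f : seq R -> R) D, polyfun d f -> (d + k <= D)%N ->
    (\int[lebesgue_tuple R k]_t (if region (fiber_region Q c.1 c.2) t then f t else 0)%:E =
     (\sum_(c <- cs) cubature c f D)%:E)%E.
  move=> c; case: (boolP (c \in fiber_cases Q)) => cQ; last by exists [::].
  by have [cs csP] := IH _ (bounded_fiber_region QM cQ); exists cs.
exists (flatten [seq [seq (c.1.1, c.2.1) :: c' | c' <- cs c] | c <- fiber_cases Q]).
move=> d f D fd dD.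
have dD' : (d < D)%N by rewrite (leq_trans _ dD)// addnS ltnS leq_addr.
rewrite integral_tuple_cons; last exact: region_integrable QM fd.
under eq_integral do rewrite (fiber_integral _ fd dD' L0 U0).
pose F c (t : k.-tuple R) := if c \in fiber_cases Q then
  (if region (fiber_region Q c.1 c.2) t then quad_fiber c.1.1 c.2.1 f D t else 0)%:E
  else 0%E.
transitivity (\int[lebesgue_tuple R k]_t (\sum_(c <- fiber_cases Q) F c t))%E.
  apply: eq_integral => t _; rewrite -sumEFin; apply: eq_big_seq => c cQ.
  by rewrite /F cQ.
transitivity (\sum_(c <- fiber_cases Q) \int[lebesgue_tuple R k]_t F c t)%E.
  apply: integral_sum => // c; rewrite /F.
  case: (c \in fiber_cases Q) (@bounded_fiber_region k Q M c QM) => [/(_ erefl) bc|_].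
    by apply: region_integrable bc _; exact: polyfun_quad_fiber fd.
  exact: integrable0.
rewrite -sumEFin [RHS]big_flatten [RHS]big_map; apply: eq_big_seq => c cQ.
rewrite big_map sumEFin -(csP c cQ d.+1)//; last 2 first.
- exact: polyfun_quad_fiber fd.
- by rewrite addSnnS.
by apply: eq_integral => t _; rewrite /F cQ.
Qed.

End cubature.

(** * Evaluating the cubature formula *)

Lemma rat_expr_big_seq (I : Type) r (s : seq I) (F : I -> (nat -> nat) -> rat) :
  (forall i, rat_expr r (F i)) -> rat_expr r (fun env => \sum_(i <- s) F i env).
Proof.
move=> Fr; elim: s => [|i s IH].
  have := rat_expr_const r 0; congr rat_expr; apply/funext => env.
  by rewrite big_nil.
have := rat_expr_add (Fr i) IH; congr rat_expr; apply/funext => env.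
by rewrite big_cons.
Qed.

Lemma rat_expr_prod_seq (I : Type) r (s : seq I) (F : I -> (nat -> nat) -> rat) :
  (forall i, rat_expr r (F i)) -> rat_expr r (fun env => \prod_(i <- s) F i env).
Proof.
move=> Fr; elim: s => [|i s IH].
  have := rat_expr_const r 1; congr rat_expr; apply/funext => env.
  by rewrite big_nil.
have := rat_expr_mul (Fr i) IH; congr rat_expr; apply/funext => env.
by rewrite big_cons.
Qed.

Fixpoint rat_exprs r (ts : seq ((nat -> nat) -> rat)) : Prop :=
  if ts is t :: ts' then rat_expr r t /\ rat_exprs r ts' else True.

Definition eval_point (ts : seq ((nat -> nat) -> rat)) env : seq rat :=
  [seq t env | t <- ts].

Lemma rat_exprsW r ts : rat_exprs r ts -> rat_exprs r.+1 ts.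
Proof. by elim: ts => //= t ts IH [/rat_exprW ? /IH]. Qed.

Lemma point_level r ts : rat_exprs r ts -> level r (eval_point ts).
Proof.
elim: ts => [//|t ts IH] /= [/rat_expr_level tr /IH tsr] env env' ee.
by rewrite /point /= (tr _ _ ee) -!/(eval_point _ _) (tsr _ _ ee).
Qed.

Lemma rat_expr_coord r ts i : rat_exprs r ts -> rat_expr r (fun env => (eval_point ts env)`_i).
Proof.
elim: ts i => [|t ts IH] [|i] /=; try by move=> _; exact: rat_expr_const.
  by case.
by case=> _; exact: IH.
Qed.

Lemma rat_expr_aff r ts a : rat_exprs r ts -> rat_expr r (fun env => aff a (eval_point ts env)).
Proof.
move=> tsr; apply: rat_expr_add; first exact: rat_expr_const.
apply: (rat_expr_big_seq _ (F := fun (i : 'I_(size a.2)) env => ratr a.2`_i * (eval_point ts env)`_i)) => i.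
by apply: rat_expr_mul; [exact: rat_expr_const|exact: rat_expr_coord].
Qed.

(** Families of functions indexed by the input, which is the variable [0]. *)
Definition evaluable (F : nat -> seq rat -> rat) :=
  forall r ts, (0 < r)%N -> rat_exprs r ts ->
    rat_expr r (fun env => F (env 0%N) (eval_point ts env)).

(** The two new variables [r] and [r.+1] run over the nodes: [r] is the denominator
    minus one and [r.+1] the numerator. *)
Lemma evaluable_quad_fiber l u (F : nat -> seq rat -> rat) (D : nat -> nat) :
  (forall r, (0 < r)%N -> bound_expr r (fun env => D (env 0%N))) -> evaluable F ->
  evaluable (fun n => quad_fiber l u (F n) (D n)).
Proof.
move=> Dr Fe r ts r0 tsr.
have tsr1 := rat_exprsW tsr; have tsr2 := rat_exprsW tsr1.
pose x env := aff l (eval_point ts env) + (env r.+1)%:R * (env r + 1)%:R^-1 *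
  (aff u (eval_point ts env) - aff l (eval_point ts env)).
have vr i : (i < r.+2)%N -> bound_expr r.+2 (fun env => env i) by exact: bound_expr_var.
have m1 : bound_expr r.+1 (fun env => env r + 1)%N.
  exact: (bound_expr_bin OpAdd (bound_expr_var (ltnSn r)) (bound_expr_const _ 1)).
have m1pos (env : nat -> nat) : (0 < env r + 1)%N by rewrite addn1.
have xr : rat_expr r.+2 x.
  apply: rat_expr_add; first exact: rat_expr_aff.
  apply: rat_expr_mul; last by apply: rat_expr_sub; exact: rat_expr_aff.
  apply: rat_expr_mul; first by apply/rat_expr_nat/bound_expr_nat/vr.
  by apply: rat_expr_inv => //; exact/bound_expr_nat/bound_exprW.
have B := Fe r.+2 ((x : (nat -> nat) -> rat) :: ts) isT (conj xr tsr2).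
have {}B := rat_expr_sum m1 B.
pose Dm env := (D (env 0%N) - (env r + 1))%N.
have Dmr : bound_expr r.+1 Dm by exact: (bound_expr_bin OpSub (Dr r.+1 isT) m1).
have D1r : bound_expr r.+1 (fun env => D (env 0%N) - 1)%N.
  exact: (bound_expr_bin OpSub (Dr r.+1 isT) (bound_expr_const _ 1)).
have W : rat_expr r.+1 (fun env => (-1) ^+ Dm env *
    (((env r + 1)`!)%:R^-1 * ((Dm env)`!)%:R^-1) * (((env r + 1) ^ (D (env 0%N) - 1))%N)%:R).
  apply: rat_expr_mul; last first.
    exact/rat_expr_nat/nat_expr_exp/(bound_expr_nat m1).
  apply: rat_expr_mul; first exact: rat_expr_sign.
  apply: rat_expr_mul; apply: rat_expr_inv => [|env]; rewrite ?fact_gt0//.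
    exact: nat_expr_fact.
  exact: nat_expr_fact.
have := rat_expr_mul (rat_expr_sub (rat_expr_aff u tsr) (rat_expr_aff l tsr))
  (rat_expr_sum (Dr r r0) (rat_expr_mul W B)).
congr rat_expr; apply/funext => env; rewrite /quad_fiber /quad; congr (_ * _).
have env0 j (e : nat -> nat) y : (r <= j)%N -> bind e j y 0%N = e 0%N.
  by move=> rj; rewrite /bind; case: eqP => // ?; lia.
apply: eq_bigr => m _; rewrite /Dm env0//.
rewrite (_ : bind env r m r = m); last by rewrite /bind eqxx.
rewrite addn1 subn1 natrX; congr (_ * _); apply: eq_bigr => j _.
have pE : eval_point ts (bind (bind env r m) r.+1 j) = eval_point ts env.
  by rewrite (level_bind _ _ (point_level tsr1))// (level_bind _ _ (point_level tsr)).
rewrite env0// env0// /= -/(eval_point ts _) pE; congr (F _ (_ :: _)).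
by rewrite /x pE /bind eqxx (ltn_eqF (ltnSn r)) eqxx addn1.
Qed.

Lemma rat_expr_cubature c (F : nat -> seq rat -> rat) (D : nat -> nat) :
  (forall r, (0 < r)%N -> bound_expr r (fun env => D (env 0%N))) -> evaluable F ->
  rat_expr 1 (fun env => cubature c (F (env 0%N)) (D (env 0%N))).
Proof.
move=> Dr; elim: c F => [|[l u] c IH] F Fe /=; first exact: (Fe 1%N [::] isT I).
exact: IH (evaluable_quad_fiber l u Dr Fe).
Qed.

(** ** Rational points of the real formula *)

Lemma ratr_rat (q : rat) : ratr q = q.
Proof. by rewrite /ratr divq_num_den. Qed.

Section ratr.
Variable R : realType.

Lemma ratr_aff a (t : seq rat) : ratr (aff a t) = aff a (map ratr t) :> R.
Proof.
rewrite /aff rmorphD ratr_rat rmorph_sum; congr (_ + _).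
apply: eq_bigr => i _; rewrite rmorphM ratr_rat; congr (_ * _).
case: (ltnP i (size t)) => it; first by rewrite (nth_map 0).
by rewrite !nth_default ?size_map// rmorph0.
Qed.

Lemma ratr_cubature c (f : seq rat -> rat) (g : seq R -> R) D :
  (forall t, ratr (f t) = g (map ratr t)) -> ratr (cubature c f D) = cubature c g D.
Proof.
elim: c f g => [|[l u] c IH] f g fg /=; first exact: fg.
apply: IH => t; rewrite /quad_fiber /quad rmorphM rmorphB /= !ratr_aff; congr (_ * _).
rewrite rmorph_sum; apply: eq_bigr => m _; rewrite rmorphM rmorph_sum; congr (_ * _).
  by rewrite !rmorphM /= !fmorphV !rmorphXn /= rmorphN1 !rmorph_nat.
apply: eq_bigr => j _; rewrite /= fg /=; congr (g (_ :: _)).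
by rewrite rmorphD !rmorphM rmorphB /= !ratr_aff fmorphV !rmorph_nat.
Qed.

End ratr.

(** * Approximating the integrand by polynomials *)

(** With [y = 1 - x / M], this is [M^-1] times the sum of the first [2 * K]
    terms of the geometric series for [(1 - y)^-1 = M / x]. *)
Definition series_inv (F : numFieldType) K M (x : F) : F :=
  M%:R^-1 * ((1 + (1 - M%:R^-1 * x)) * \sum_(j < K) ((1 - M%:R^-1 * x) ^+ 2) ^+ j).

Definition inv_prod_approx (F : numFieldType) k K M (t : seq F) : F :=
  \prod_(i < k) series_inv K M t`_i.

Lemma series_invE (F : numFieldType) K M (x : F) : (0 < M)%N -> x != 0 ->
  series_inv K M x = x^-1 * (1 - ((1 - M%:R^-1 * x) ^+ 2) ^+ K).
Proof.
move=> M0 x0; have M0' : M%:R != 0 :> F by rewrite pnatr_eq0 -lt0n.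
set y := 1 - _ * x; have xE : x = M%:R * (1 - y) by rewrite /y subKr mulVKf.
have y1 : 1 - y != 0 by move: x0; rewrite {1}xE mulf_eq0 negb_or => /andP[].
have geo : 1 - (y ^+ 2) ^+ K = (1 - y) * ((1 + y) * \sum_(j < K) (y ^+ 2) ^+ j).
  rewrite -[1 in LHS](expr1n _ K) subrXX mulrA; congr (_ * _); first by ring.
  by apply: eq_bigr => i _; rewrite expr1n mul1r.
by rewrite /series_inv -/y geo {1}xE invfM -mulrA mulKf.
Qed.

Lemma evaluable_approx k kappa M : evaluable (fun n => inv_prod_approx k (kappa * n)%N M).
Proof.
move=> r ts r0 tsr; rewrite /inv_prod_approx; apply: (rat_expr_prod_seq _
  (F := fun (i : 'I_k) env => series_inv (kappa * env 0)%N M (eval_point ts env)`_i)) => i.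
have yr : rat_expr r (fun env => 1 - M%:R^-1 * (eval_point ts env)`_i).
  apply: rat_expr_sub; first exact: rat_expr_const.
  by apply: rat_expr_mul; [exact: rat_expr_const|exact: rat_expr_coord].
have Kr : bound_expr r (fun env => kappa * env 0)%N.
  exact: (bound_expr_bin OpMul (bound_expr_const r kappa) (bound_expr_var r0)).
have S := rat_expr_sum Kr (rat_expr_sqr_exp (rat_exprW yr) (bound_expr_var (ltnSn r))).
have := rat_expr_mul (rat_expr_const r M%:R^-1)
  (rat_expr_mul (rat_expr_add (rat_expr_const r 1) yr) S).
congr rat_expr; apply/funext => env; rewrite /series_inv; do 2 congr (_ * _).
apply: eq_bigr => j _; rewrite (level_bind _ _ (point_level tsr))//.
by rewrite /bind eqxx.
Qed.

Section approx.
Variable R : realType.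

Lemma polyfun_approx k K M :
  polyfun (k * K.*2.+1) (fun t : seq R => inv_prod_approx k K M t).
Proof.
apply: (polyfun_prod _ (F := fun i t => series_inv K M t`_i)) => i.
have yP : polyfun 1 (fun t : seq R => 1 - M%:R^-1 * t`_i).
  apply: polyfunB; first exact: polyfun_const.
  by apply: polyfunZ; exact: polyfun_coord.
apply: polyfunZ; apply: (@polyfun_mul _ 1 K.*2).
  by apply: polyfun_add => //; exact: polyfun_const.
elim: K => [|K IH].
  have := @polyfun_const R 0 0; congr polyfun; apply/funext => t.
  by rewrite big_ord0.
have yK : polyfun K.*2 (fun t : seq R => ((1 - M%:R^-1 * t`_i) ^+ 2) ^+ K).
  have := @polyfun_prod _ _ K (fun _ => _) (fun _ => polyfun_mul yP yP).
  rewrite addn1 muln2; congr polyfun; apply/funext => t.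
  by rewrite prodr_const card_ord -expr2.
have := polyfun_add (polyfunW _ IH) (polyfunW _ yK).
move=> /(_ K.+1.*2); rewrite leq_double leqnSn => /(_ isT isT).
by congr polyfun; apply/funext => t; rewrite big_ord_recr.
Qed.

Lemma ratr_approx k K M (t : seq rat) :
  ratr (inv_prod_approx k K M t) = inv_prod_approx k K M (map ratr t) :> R.
Proof.
rewrite /inv_prod_approx rmorph_prod; apply: eq_bigr => i _.
have -> : (map ratr t)`_i = ratr t`_i :> R.
  case: (ltnP i (size t)) => it; first by rewrite (nth_map 0).
  by rewrite !nth_default ?size_map// rmorph0.
have yE : ratr (1 - M%:R^-1 * t`_i) = 1 - M%:R^-1 * ratr t`_i :> R.
  by rewrite rmorphB rmorph1 rmorphM fmorphV rmorph_nat.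
rewrite /= /series_inv rmorphM fmorphV rmorph_nat rmorphM rmorphD rmorph1 /= yE.
rewrite rmorph_sum; do 2 congr (_ * _); apply: eq_bigr => j _.
by rewrite /= !rmorphXn /= yE.
Qed.

(** Weierstrass's product inequality. *)
Lemma prod_one_sub n (e : nat -> R) : (forall i, (i < n)%N -> 0 <= e i <= 1) ->
  0 <= \prod_(i < n) (1 - e i) <= 1 /\
  1 - \prod_(i < n) (1 - e i) <= \sum_(i < n) e i.
Proof.
elim: n => [|n IH] en; first by rewrite !big_ord0 subrr ler01 lexx.
have [] := IH (fun i ni => en i (leqW ni)); rewrite !big_ord_recr /=.
move: (\prod_(i < n) _) (\sum_(i < n) _) (en n (ltnSn n)).
by move=> p s /andP[e0 e1] /andP[p0 p1] le; split; [apply/andP; split|]; nra.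
Qed.

Lemma approx_error k K M (a : R) (t : seq R) : 0 < a ->
  (forall i, (i < k)%N -> a <= t`_i <= M%:R) ->
  `|(\prod_(i < k) t`_i)^-1 - inv_prod_approx k K M t|
    <= (a^-1) ^+ k * k%:R * ((1 - M%:R^-1 * a) ^+ 2) ^+ K.
Proof.
move=> a0 tk; set rho := (1 - _) ^+ 2.
pose e i := ((1 - M%:R^-1 * t`_i) ^+ 2) ^+ K.
have pos i : (i < k)%N -> 0 < t`_i by move=> /tk /andP[+ _]; exact: lt_le_trans.
have ek i : (i < k)%N -> 0 <= e i <= rho ^+ K /\ e i <= 1.
  move=> ik; have /andP[ai iM] := tk i ik; have t0 := pos i ik.
  have M0 : 0 < M%:R :> R := lt_le_trans t0 iM.
  have y0 : 0 <= 1 - M%:R^-1 * t`_i by rewrite subr_ge0 mulrC ler_pdivrMr// mul1r.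
  have ya : 1 - M%:R^-1 * t`_i <= 1 - M%:R^-1 * a.
    by rewrite lerD2l lerN2 ler_pM2l// invr_gt0.
  have y1 : 1 - M%:R^-1 * t`_i <= 1 by rewrite gerBl mulr_ge0// ?invr_ge0 ltW.
  rewrite /e /rho; split; last by rewrite !exprn_ile1 ?exprn_ge0.
  rewrite !exprn_ge0//=; have ya0 := le_trans y0 ya.
  by rewrite lerXn2r ?nnegrE ?exprn_ge0// lerXn2r ?nnegrE.
have [] := @prod_one_sub k e; first by move=> i /ek[/andP[-> _] ->].
move=> /andP[p0 p1] ple.
have -> : inv_prod_approx k K M t = (\prod_(i < k) t`_i)^-1 * \prod_(i < k) (1 - e i).
  rewrite /inv_prod_approx -prodfV -big_split /=; apply: eq_bigr => i _.
  have [ti0 /andP[ai iM]] := (pos i (ltn_ord i), tk i (ltn_ord i)).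
  rewrite series_invE ?gt_eqF// -(ltr0n R); exact: lt_le_trans iM.
rewrite -[X in X - _]mulr1 -mulrBr normrM [X in _ * X]ger0_norm ?subr_ge0//.
rewrite -[leRHS]mulrA; apply: ler_pM => //.
- by rewrite subr_ge0.
- rewrite -prodfV normr_prod -[k in leRHS]card_ord -prodr_const.
  apply: ler_prod => i _; rewrite normr_ge0 /= gtr0_norm ?invr_gt0 ?pos//.
  have /andP[ai _] := tk i (ltn_ord i).
  by rewrite lef_pV2 ?posrE ?pos.
apply: le_trans ple _; rewrite mulr_natl -[k in leRHS]card_ord -sumr_const.
by apply: ler_sum => i _; have [/andP[]] := ek i (ltn_ord i).
Qed.

(** It suffices that [rho ^ kappa] is at most [1 / (2 * (C + 1))]. *)
Lemma geometric_bound (C rho : R) : 0 <= rho < 1 -> 0 <= C ->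
  exists kappa : nat, forall n, (1 <= n)%N -> C * rho ^+ (kappa * n)%N <= 2 ^- n.
Proof.
move=> /andP[rho0 rho1] C0.
have e0 : 0 < (2 * (C + 1))^-1 by rewrite invr_gt0; nra.
have rn : `|rho| < 1 by rewrite ger0_norm.
have /cvgrPdist_lt /(_ _ e0) [N _ /(_ N (leqnn N))] := cvg_expr rn.
rewrite /= sub0r normrN ger0_norm ?exprn_ge0// => rN.
exists N => n n1; rewrite exprM.
have c1 : (2 * (C + 1)) ^- n = 2 ^- n * (C + 1) ^- n by rewrite exprMn invfM.
have : (rho ^+ N) ^+ n <= 2 ^- n * (C + 1) ^- n.
  rewrite -c1 -exprVn; apply: lerXn2r; rewrite ?nnegrE; last exact: ltW.
    exact: exprn_ge0.
  exact: ltW.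
move=> /(ler_wpM2l C0) /le_trans; apply.
rewrite mulrCA ger_pMr ?invr_gt0 ?exprn_gt0//.
have C1 : 0 < C + 1 by lra.
rewrite ler_pdivrMr ?exprn_gt0// mul1r.
have : C + 1 <= (C + 1) ^+ n by rewrite ler_eXnr//; lra.
by apply: le_trans; lra.
Qed.

End approx.

(** * Polytopes in the positive orthant *)

Section polytope.
Variable R : realType.

Definition constr_of_ineq m k (A : 'M[rat]_(m, k)) (b : 'cV[rat]_m) (i : 'I_m) : constr :=
  (false, (b i ord0, [seq - A i j | j <- enum 'I_k])).

Lemma region_polyhedron m k (A : 'M[rat]_(m, k)) (b : 'cV[rat]_m) :
  polyhedron A b =
  [set t : k.-tuple R | region [seq constr_of_ineq A b i | i <- enum 'I_m] t].
Proof.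
have satE i (t : k.-tuple R) : sat (constr_of_ineq A b i) t =
    (\sum_(j < k) ratr (A i j) * tnth t j <= ratr (b i ord0)).
  have sz : (size [seq - A i j | j <- enum 'I_k] <= k)%N.
    by rewrite size_map size_enum_ord.
  rewrite /sat /= (@aff_wide _ k (_, _))// -[in RHS]subr_ge0 -sumrN; congr (0 <= _ + _).
  apply: eq_bigr => j _ /=; rewrite (nth_map j) ?size_enum_ord// nth_ord_enum.
  by rewrite rmorphN mulNr (tnth_nth 0).
apply/seteqP; split=> t /=.
  by move=> Pt; apply/allP => _ /mapP[i _ ->]; rewrite satE; exact: Pt.
by move=> /allP Pt i; rewrite -satE; apply/Pt/map_f; rewrite mem_enum.
Qed.

(** The polytope is compact, so the coordinate attains its minimum on it. *)
Lemma polyhedron_lower_bound m k (A : 'M[rat]_(m, k)) (b : 'cV[rat]_m) (i : 'I_k) :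
  bounded_tuples (@polyhedron R m k A b) -> @polyhedron R m k A b `<=` @positive_orthant R k ->
  exists2 a : R, 0 < a & forall t, polyhedron A b t -> a <= tnth t i.
Proof.
move=> [M PM] Ppos; pose tup (v : 'rV[R]_k) := [tuple v ord0 j | j < k].
pose P' : set 'rV[R]_k := [set v | polyhedron A b (tup v)].
have tupE v j : tnth (tup v) j = v ord0 j by rewrite tnth_mktuple.
have PE (t : k.-tuple R) : tup (\row_j tnth t j) = t.
  by apply: eq_from_tnth => j; rewrite tupE mxE.
have [[t0 Pt0]|empty] := pselect (exists t, @polyhedron R m k A b t); last first.
  by exists 1 => // t Pt; case: empty; exists t.
have P'0 : P' !=set0 by exists (\row_j tnth t0 j); rewrite /P' /= PE.
have closedP' : closed P'.
  have -> : P' = \bigcap_(l in [set: 'I_m])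
      [set v : 'rV[R]_k | \sum_(j <- enum 'I_k) ratr (A l j) * v ord0 j <= ratr (b l ord0)].
    apply/seteqP; split=> v /=.
      move=> Pv l _ /=; rewrite big_enum /=; apply: le_trans (Pv l).
      by under [leRHS]eq_bigr do rewrite tupE.
    move=> Pv l; have := Pv l I; rewrite /= big_enum /=; apply: le_trans.
    by under eq_bigr do rewrite tupE.
  apply: closed_bigI => l _.
  apply: (@preimage_closed _ _ (fun v : 'rV[R]_k => \sum_(j <- enum 'I_k) ratr (A l j) * v ord0 j)
    [set x | x <= ratr (b l ord0)]); last exact: closed_le.
  move=> v _; elim: (enum 'I_k) => [|j s IH].
    have -> : (fun v : 'rV[R]_k => \sum_(j <- [::]) ratr (A l j) * v ord0 j) = cst 0.
      by apply/funext => w; rewrite big_nil.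
    exact: cst_continuous.
  have -> : (fun v : 'rV[R]_k => \sum_(j <- j :: s) ratr (A l j) * v ord0 j) =
      (fun v => ratr (A l j) * v ord0 j + \sum_(j <- s) ratr (A l j) * v ord0 j).
    by apply/funext => w; rewrite big_cons.
  apply: continuousD IH; apply: continuousM; first exact: cst_continuous.
  exact: coord_continuous.
have compactP' : compact P'.
  apply: subclosed_compact closedP' (@rV_compact _ _ (fun=> `[- M, M]%classic) _) _.
    by move=> j; exact: segment_compact.
  move=> v /PM Mv j /=; rewrite in_itv /= -ler_norml.
  by have := Mv j; rewrite tupE.
have [c cP' cmin] := @EVT_min_rV R k (fun v => v ord0 i) P' P'0 compactP'
  (continuous_subspaceT (@coord_continuous R 1 k ord0 i)).
exists (c ord0 i).
  by move: cP'; rewrite inE => /Ppos /(_ i); rewrite tupE.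
move=> t Pt; have := cmin (\row_j tnth t j); rewrite mxE; apply.
by rewrite inE /P' /= PE.
Qed.

Lemma polytope_lower_bound m k (A : 'M[rat]_(m, k)) (b : 'cV[rat]_m) :
  bounded_tuples (@polyhedron R m k A b) -> @polyhedron R m k A b `<=` @positive_orthant R k ->
  exists2 a : R, 0 < a <= 1 & forall t, polyhedron A b t -> forall i, a <= tnth t i.
Proof.
move=> bP Ppos.
have /choice[a aP] : forall i : 'I_k, exists a : R, 0 < a /\
    forall t, polyhedron A b t -> a <= tnth t i.
  by move=> i; have [a a0 aP] := polyhedron_lower_bound i bP Ppos; exists a.
exists (\big[Num.min/1]_i a i).
  apply/andP; split; last exact: bigmin_le_id.
  by apply: lt_bigmin => // i _; have [] := aP i.
by move=> t Pt i; have [_ /(_ t Pt)] := aP i; exact: bigmin_inf.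
Qed.

End polytope.

(** The error on the integral is at most that on the integrand times the volume,
    which is finite. *)
Lemma approx_integral_error (R : realType) k Q M (a : R) :
  0 < a -> (forall t : k.-tuple R, region Q t -> forall i, a <= tnth t i <= M%:R) ->
  bounded_region k Q (M%:R : R) ->
  exists2 C : R, 0 <= C & forall K,
    (`| \int[lebesgue_tuple R k]_t (if region Q t then inv_prod_approx k K M t else 0)%:E -
        inv_prod_integral [set t : k.-tuple R | region Q t] |
      <= (C * ((1 - M%:R^-1 * a) ^+ 2) ^+ K)%:E)%E.
Proof.
move=> a0 aM QM; set P := [set t : k.-tuple R | region Q t].
pose mu := lebesgue_tuple R k.
have mP : measurable P.
  rewrite -[P]setTI; exact: (@region_measurable R k Q measurableT [set true] I).
have regE (g : k.-tuple R -> R) :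
    (\int[mu]_t (if region Q t then g t else 0)%:E = \int[mu]_(t in P) (g t)%:E)%E.
  rewrite [RHS]integral_mkcond; apply: eq_integral => t _.
  rewrite patchE (_ : (t \in P) = region Q t); first by case: ifP.
  by apply/idP/idP; rewrite inE.
have muP : (mu P < +oo)%E.
  have /integrableP[_] := region_integrable QM (polyfun_const 0 1).
  under eq_integral => t _.
    rewrite (_ : (`|_|)%E = (if region Q t then 1 else 0)%:E); last first.
      by case: ifP; rewrite /= ?normr1 ?normr0.
    over.
  by rewrite (regE (fun=> 1)) integral_cst// mul1e.
pose h (t : k.-tuple R) := (\prod_(i < k) tnth t i)^-1.
have hE (t : k.-tuple R) : h t = (\prod_(i < k) t`_i)^-1.
  by congr (_^-1); apply: eq_bigr => i _; rewrite (tnth_nth 0).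
pose E K := (a^-1) ^+ k * k%:R * ((1 - M%:R^-1 * a) ^+ 2) ^+ K.
have errE K t : P t -> `|h t - inv_prod_approx k K M t| <= E K.
  move=> Pt; rewrite hE; apply: approx_error => // i ik.
  by have := aM t Pt (Ordinal ik); rewrite (tnth_nth 0).
have bnd (g : k.-tuple R -> R) B : measurable_fun P g ->
    (forall t, P t -> `|g t| <= B) -> mu.-integrable P (EFin \o g).
  move=> mg gB; apply: measurable_bounded_integrable => //.
  exists B; rewrite num_real; split=> // x Bx t Pt.
  exact: le_trans (gB t Pt) (ltW Bx).
have mapprox K : measurable_fun P (fun t : k.-tuple R => inv_prod_approx k K M t).
  apply: measurable_funTS; exact: polyfun_measurable (polyfun_approx R k K M).
have iapprox K : mu.-integrable P (fun t : k.-tuple R => (inv_prod_approx k K M t)%:E).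
  have [B PB] := polyfun_bounded M%:R (polyfun_approx R k K M).
  apply: (bnd _ B) => // t Pt; apply: PB; apply: QM => //; exact: size_tuple.
have mh : measurable_fun P h.
  have pos (t : k.-tuple R) : P t -> 0 < \prod_(i < k) tnth t i.
    move=> Pt; apply: prodr_gt0 => i _; have /andP[ai _] := aM t Pt i.
    exact: lt_le_trans ai.
  apply: (eq_measurable_fun (fun t : k.-tuple R => (\prod_(i < k) tnth t i) `^ (-1))).
    by move=> t; rewrite inE => Pt; rewrite powR_inv1// ltW// pos.
  apply: measurable_funTS.
  have mprod : measurable_fun setT (fun t : k.-tuple R => \prod_(i < k) tnth t i).
    have := @polyfun_measurable R k _ _
      (@polyfun_prod R 1 k (fun i t => t`_i) (fun i => polyfun_coord R 0 i)).
    congr measurable_fun; apply/funext => t; apply: eq_bigr => i _.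
    by rewrite (tnth_nth 0).
  exact: (measurableT_comp (measurable_powR (-1)) mprod).
have ih : mu.-integrable P (fun t => (h t)%:E).
  apply: (bnd _ (`|a^-1| ^+ k)) => // t Pt.
  rewrite /h -prodfV normr_prod -[k in leRHS]card_ord -prodr_const.
  apply: ler_prod => i _; rewrite normr_ge0 /= gtr0_norm; last first.
    by rewrite invr_gt0; have /andP[+ _] := aM t Pt i; exact: lt_le_trans.
  rewrite gtr0_norm ?invr_gt0// lef_pV2 ?posrE//; have /andP[+ _] := aM t Pt i => //.
  exact: lt_le_trans.
have muPfin : mu P \is a fin_num by rewrite ge0_fin_numE.
exists (fine (mu P) * ((a^-1) ^+ k * k%:R)) => [|K].
  by rewrite !mulr_ge0 ?fine_ge0// exprn_ge0// invr_ge0 ltW.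
rewrite regE /inv_prod_integral -integralB_EFin//; last exact: iapprox.
apply: le_trans (le_abse_integral _ _ _) _ => //.
  by apply/measurable_EFinP; exact: measurable_funB.
rewrite -mulrA EFinM fineK// muleC -(integral_cst mu mP).
apply: ge0_le_integral => //.
- by apply: measurableT_comp => //; apply/measurable_EFinP; exact: measurable_funB.
- move=> t Pt; rewrite /= lee_fin distrC; exact: errE.
Qed.

Theorem theorem1p1 (R : realType) (k : nat) (hk : (1 <= k)%N)
    (P : set (k.-tuple R)) (hP : rational_polytope P)
    (hpos : P `<=` @positive_orthant R k) :
  exists (p : prog) (C K : R), 0 < C /\ 0 < K /\
    forall n : nat, (1 <= n)%N ->
      exists (t : nat) (q : rat),
        computes_in p n t q /\
        t%:R <= K * n%:R `^ C /\
        (`| (ratr q)%:E - inv_prod_integral P | <= (2 ^- n)%:E)%E.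
Proof.
have [bP [m [A [b PE]]]] := hP.
have [a /andP[a0 a1] aP] : exists2 a : R, 0 < a <= 1 &
    forall t, P t -> forall i, a <= tnth t i.
  by move: bP hpos; rewrite PE; exact: polytope_lower_bound.
have [M0 M0P] := bP; pose M := Num.bound `|M0|.
have M0M : `|M0| < M%:R by exact: archi_boundP.
have Mpos : (0 : R) < M%:R by apply: le_lt_trans M0M.
have M1 : (1 : R) <= M%:R by rewrite ler1n -(ltr0n R).
rewrite region_polyhedron in PE; set Q := map _ _ in PE.
have PQ (t : k.-tuple R) : region Q t -> P t by rewrite PE.
have QM : bounded_region k Q (M%:R : R).
  move=> t tk; rewrite -(in_tupleE t); move: (in_tuple t); rewrite tk => {tk}t Qt i.
  case: (ltnP i k) => ik; last by rewrite nth_default ?size_tuple// normr0 ltW.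
  have := M0P t (PQ t Qt) (Ordinal ik); rewrite (tnth_nth 0) => /le_trans; apply.
  by apply: ltW (le_lt_trans (ler_norm _) M0M).
have aM (t : k.-tuple R) : region Q t -> forall i, a <= tnth t i <= M%:R.
  move=> Qt i; rewrite aP//=; last exact: PQ.
  rewrite (tnth_nth 0); apply: le_trans (ler_norm _) _; apply: QM => //.
  exact: size_tuple.
have [C C0 err] := approx_integral_error a0 aM QM.
rewrite -PE in err.
have [kappa kappaP] : exists kappa : nat, forall n, (1 <= n)%N ->
    C * ((1 - M%:R^-1 * a) ^+ 2) ^+ (kappa * n)%N <= 2 ^- n.
  apply: geometric_bound => //.
  have y0 : 0 <= 1 - M%:R^-1 * a by rewrite subr_ge0 mulrC ler_pdivrMr// mul1r (le_trans a1).
  have y1 : 1 - M%:R^-1 * a < 1 by rewrite gtrBl mulr_gt0// invr_gt0.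
  by rewrite exprn_ge0//= exprn_ilt1.
have [cs csP] := integral_polyhedron QM.
(* the degree of the approximation, plus one for each integration *)
pose D n := (k * (kappa * n).*2.+1 + k)%N.
have Dr r : (0 < r)%N -> bound_expr r (fun env => D (env 0%N)).
  move=> r0; have kn := bound_expr_bin OpMul (bound_expr_const r kappa) (bound_expr_var r0).
  have := bound_expr_bin OpAdd (bound_expr_bin OpMul (bound_expr_const r k)
    (bound_expr_bin OpAdd (bound_expr_const r 1) (bound_expr_bin OpAdd kn kn)))
    (bound_expr_const r k).
  by congr bound_expr; apply/funext => env; rewrite /D /= -addnn.
have [p [c pP]] := rat_expr_program (rat_expr_big_seq cs
  (fun c => rat_expr_cubature c Dr (@evaluable_approx k kappa M))).
exists p, c.+1%:R, (3 ^+ c); split; first by rewrite ltr0n.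
split=> [|n n1]; first exact: exprn_gt0.
have [t tn ct] := pP n.
exists t; eexists; split; first exact: ct.
split.
  rewrite powR_mulrn// -natrX -natrX -natrM ler_nat (leq_trans tn)//.
  rewrite expnS mulnCA -expnMn.
  apply: (@leq_trans ((3 * n) ^ c)); first by apply: leq_exp_base; lia.
  by rewrite leq_pmull.
apply: le_trans (le_trans (err (kappa * n)%N) _); last first.
  by rewrite lee_fin; exact: kappaP.
rewrite (csP _ _ (D n) (polyfun_approx R k (kappa * n) M))//.
rewrite rmorph_sum le_eqVlt (eq_bigr (fun c =>
  cubature c (fun t : seq R => inv_prod_approx k (kappa * n) M t) (D n))) ?eqxx//.
by move=> i _; apply: ratr_cubature => t'; exact: ratr_approx.
Qed.
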